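(* Let $Q$ be a quiver of Type IV (with oriented cycle $a_1\to\cdots\to a_k\to a_1$, $k\ge3$, and subquivers $Q^{(1)},\dots,Q^{(k)}$ as in the definition) in which each $Q^{(i)}$ is either empty or a single vertex. Let $t$ be the number of nonempty $Q^{(i)}$ and let $m=|\{i\in[k]:\deg(a_i)=4\}|$, where $\deg$ is the degree in $Q$. Then every maximal green sequence of $Q$ has length at least $2k-2+t+m$.
   Context: A quiver is a finite directed graph with no loops or oriented 2-cycles. Mutation $\mu_v$: (1) for every path $i\to v\to j$ add an arrow $i\to j$; (2) reverse all arrows incident to $v$; (3) remove a maximal collection of oriented 2-cycles, and arrows between two frozen vertices. The framed quiver $\widehat Q$ has an additional frozen vertex $i'$ and arrow $i\to i'$ for each vertex $i$; only mutable vertices are mutated. A mutable vertex $i$ of a quiver obtained from $\widehat Q$ by mutations is green if there is no arrow $j'\to i$ from a frozen vertex and red if there is no arrow $i\to j'$ to a frozen vertex. A maximal green sequence is a sequence $(i_1,\dots,i_r)$ of mutable vertices such that each $i_j$ is green in $\mu_{i_{j-1}}\cdots\mu_{i_1}(\widehat Q)$ and all mutable vertices are red in $\mu_{i_r}\cdots\mu_{i_1}(\widehat Q)$; its length is $r$. A quiver is of mutation type $\mathbb{A}$ if obtainable by mutations from an orientation of a path with the same number of vertices. A vertex $c$ is a connecting vertex of a quiver if it has degree at most 2 and, if of degree 2, lies on an oriented 3-cycle of that quiver. Type IV: $Q$ has a full subquiver $R$ which is an oriented cycle $a_1\to a_2\to\cdots\to a_k\to a_1$ with $k\ge 3$; for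 each arrow $a_i\to a_{i+1}$ (indices mod $k$) there may be a vertex $b_i\notin R_0$ with $b_i\to a_i\to a_{i+1}\to b_i$ a full subquiver of $Q$, and no other vertices outside $R$ are adjacent to $R$; removing the vertices and arrows of $R$ leaves quivers $Q^{(1)},\dots,Q^{(k)}$, some possibly empty, each nonempty $Q^{(i)}$ of mutation type $\mathbb{A}$ with $b_i$ as a connecting vertex. *)

(* Defs.v *)
From mathcomp Require Import all_boot.

Set Implicit Arguments.
Unset Strict Implicit.
Unset Printing Implicit Defensive.

(* [arr i j] is the number of arrows i -> j, so multiple arrows are allowed. *)
Record quiver (V : finType) : Type := Quiver {
  arr : V -> V -> nat;
  arr_noloop : forall i, arr i i = 0;
  arr_no2cycle : forall i j, arr i j = 0 \/ arr j i = 0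
}.

Section Mutation.
Variables (V : finType) (F : {set V}) (v : V).

Definition add_paths (q : V -> V -> nat) (i j : V) : nat :=
  q i j + q i v * q v j.

Definition reverse_at (q : V -> V -> nat) (i j : V) : nat :=
  if (i == v) || (j == v) then q j i else q i j.

(* Removing a maximal collection of 2-cycles between i and j removes
   [minn (q i j) (q j i)] arrows in each direction, which is what the
   truncated subtraction does. *)
Definition cancel_2cycles (q : V -> V -> nat) (i j : V) : nat :=
  q i j - q j i.

Definition remove_frozen (q : V -> V -> nat) (i j : V) : nat :=
  if (i \in F) && (j \in F) then 0 else q i j.

Definition mut_arr (q : V -> V -> nat) : V -> V -> nat :=
  remove_frozen (cancel_2cycles (reverse_at (add_paths q))).

Lemma mut_arr_noloop q i : mut_arr q i i = 0.
Proof.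
by rewrite /mut_arr /remove_frozen /cancel_2cycles subnn; case: ifP.
Qed.

Lemma mut_arr_no2cycle q i j : mut_arr q i j = 0 \/ mut_arr q j i = 0.
Proof.
rewrite /mut_arr /remove_frozen /cancel_2cycles.
set r := reverse_at _.
case: ifP => _; first by left.
case: ifP => _; first by right.
by case/orP: (leq_total (r i j) (r j i)) => le_r; [left | right];
   apply/eqP; rewrite subn_eq0.
Qed.

(* Mutation at [v] of the quiver [Q] with set of frozen vertices [F]. *)
Definition mutate (Q : quiver V) : quiver V :=
  Quiver (mut_arr_noloop (arr Q)) (mut_arr_no2cycle (arr Q)).

End Mutation.

(* [mutations F [:: v1; ...; vr] Q] is mu_vr ( ... (mu_v1 Q)). *)
Definition mutations (V : finType) (F : {set V}) (s : seq V) (Q : quiver V) :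
  quiver V := foldl (fun R v => mutate F v R) Q s.

Definition degree (V : finType) (Q : quiver V) (v : V) : nat :=
  \sum_(w : V) (arr Q v w + arr Q w v).

Section FullSubquiver.
Variables (V : finType) (Q : quiver V) (C : {set V}).

(* The full subquiver of [Q] on the vertex set [C]. *)
Definition full_subquiver : quiver {x : V | x \in C} :=
  @Quiver {x : V | x \in C}
    (fun x y => arr Q (val x) (val y))
    (fun x => arr_noloop Q (val x))
    (fun x y => arr_no2cycle Q (val x) (val y)).

End FullSubquiver.

Section Framed.
Variables (V : finType) (Q : quiver V).

(* The mutable vertex i is [inl i], its frozen copy i' is [inr i]. *)
Definition framed_arr (x y : V + V) : nat :=
  match x, y with
  | inl i, inl j => arr Q i j
  | inl i, inr j => (i == j)
  | inr _, _ => 0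
  end.

Lemma framed_arr_noloop x : framed_arr x x = 0.
Proof. by case: x => i //=; exact: arr_noloop. Qed.

Lemma framed_arr_no2cycle x y : framed_arr x y = 0 \/ framed_arr y x = 0.
Proof.
by case: x y => [i|i] [j|j] /=; try (by left); try (by right);
   exact: arr_no2cycle.
Qed.

Definition framed : quiver (V + V)%type :=
  Quiver framed_arr_noloop framed_arr_no2cycle.

End Framed.

Definition frozen_vertices (V : finType) : {set V + V} :=
  [set x | if x is inr _ then true else false].

Definition framed_mutations (V : finType) (s : seq V) (Q : quiver V) :
  quiver (V + V)%type :=
  mutations (frozen_vertices V) (map inl s) (framed Q).

Definition green (V : finType) (R : quiver (V + V)%type) (i : V) : Prop :=
  forall j : V, arr R (inr j) (inl i) = 0.

Definition red (V : finType) (R : quiver (V + V)%type) (i : V) : Prop :=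
  forall j : V, arr R (inl i) (inr j) = 0.

Definition maximal_green_sequence (V : finType) (Q : quiver V) (s : seq V) :
  Prop :=
  (forall (s1 : seq V) (i : V) (s2 : seq V),
      s = s1 ++ i :: s2 -> green (framed_mutations s1 Q) i) /\
  (forall i : V, red (framed_mutations s Q) i).

(* [Q] is an orientation of the path visiting V in the order
   [p 0, p 1, ..., p (#|V| - 1)]. *)
Definition path_orientation (V : finType) (Q : quiver V) : Prop :=
  exists2 p : 'I_#|V| -> V, bijective p &
    forall i j : 'I_#|V|,
      arr Q (p i) (p j) + arr Q (p j) (p i) = ((i.+1 == j) || (j.+1 == i)).

(* The path is taken on the vertex set of [Q] itself; since mutation commutes
   with relabelling vertices, no isomorphism is needed here. *)
Definition mutation_type_A (V : finType) (Q : quiver V) : Prop :=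
  exists (P : quiver V) (s : seq V),
    path_orientation P /\ arr Q =2 arr (mutations set0 s P).

Definition on_oriented_3cycle (V : finType) (Q : quiver V) (c : V) : Prop :=
  exists y z : V, [/\ 0 < arr Q c y, 0 < arr Q y z & 0 < arr Q z c].

Definition connecting_vertex (V : finType) (Q : quiver V) (c : V) : Prop :=
  degree Q c <= 2 /\ (degree Q c = 2 -> on_oriented_3cycle Q c).

(* The vertices [c 0, ..., c (n - 1)] span a full subquiver which is the
   oriented cycle c 0 -> c 1 -> ... -> c (n - 1) -> c 0; [ordS] is the cyclic
   successor on ['I_n]. *)
Definition full_oriented_cycle (V : finType) (Q : quiver V) (n : nat)
  (c : 'I_n -> V) : Prop :=
  injective c /\ forall i j : 'I_n, arr Q (c i) (c j) = (j == ordS i).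

(* [a] lists the central cycle R; [b i] is the vertex b_i when there is one;
   [C i] is the vertex set of Q^(i), which is the full subquiver on [C i]. *)
Record typeIV (V : finType) (Q : quiver V) (k : nat)
  (a : 'I_k -> V) (b : 'I_k -> option V) (C : 'I_k -> {set V}) : Prop := {
  typeIV_ge3 : 3 <= k;
  typeIV_cycle : full_oriented_cycle Q a;
  typeIV_spike_notin : forall i x, b i = Some x -> x \notin codom a;
  typeIV_spike : forall i x, b i = Some x ->
    full_oriented_cycle Q (tnth [tuple x; a i; a (ordS i)]);
  (* The arrows b_i -> a_i and a_(i+1) -> b_i are the only ones joining R to
     the rest of Q. *)
  typeIV_into_R : forall i x, x \notin codom a ->
    0 < arr Q x (a i) -> b i = Some x;
  typeIV_from_R : forall i x, x \notin codom a ->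
    0 < arr Q (a (ordS i)) x -> b i = Some x;
  (* Q with R removed is the disjoint union of the Q^(i). *)
  typeIV_cover : forall x, x \notin codom a <-> exists i, x \in C i;
  typeIV_disjoint : forall i j, i != j -> [disjoint C i & C j];
  typeIV_separated : forall i j x y, i != j -> x \in C i -> y \in C j ->
    arr Q x y = 0;
  typeIV_spike_in : forall i x, b i = Some x -> x \in C i;
  typeIV_typeA : forall i, C i != set0 ->
    mutation_type_A (full_subquiver Q (C i));
  typeIV_connecting : forall i, C i != set0 ->
    exists2 x : {x : V | x \in C i}, b i = Some (val x) &
      connecting_vertex (full_subquiver Q (C i)) x
}.

(* Main.v *)
(** A quiver of Type IV comes from a triangulation of a once-punctured polygon:
    the vertices of the central cycle are the arcs ending at the puncture
    (radii), and a spike b_i is an arc cutting off an ear between the radii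
    a_i and a_(i+1).  Mutations are flips of tagged arcs, and the c-vectors
    (rows of the frozen part) are shear coordinates, given by an explicit
    local formula.  With this formula a triangulation without green arcs has
    k notched radii, and its ears are the initial ones rotated by one step.
    The bound is then a bound on the number of flips: the potential [phi]
    below rises by at most 1 under any flip.  One part of it records the
    number of radii, which has to go down from k plain ones and then up to k
    notched ones; this contributes 2k-2.  The other part records at which of
    its two ends a boundary edge has been cut off; this changes for t + m of
    the boundary edges. *)

Require Import Defs.
From mathcomp Require Import all_boot all_algebra zify ring.

Set Implicit Arguments.
Unset Strict Implicit.
Unset Printing Implicit Defensive.

Import GRing.Theory Num.Theory.

Section Triangulations.
Local Open Scope ring_scope.
Variable V : finType.

(** * Trees of triangles, with their exchange matrices and c-vectors *)

Definition pos (x : int) : int := if 0 <= x then x else 0.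

(** Boundary edges. [Lam a f] is the edge just after the endpoint of the initial
    radius [a], with [f] telling whether [a] has degree 4; [Mu b] is the second
    edge of the ear cut off by the spike [b].  A tree is a triangulated polygon
    with one distinguished edge, its root: [Node k A B] is the arc [k] together
    with the triangle below it, whose two other sides are the roots of [A] and
    [B]. *)
Inductive leaf := Lam of V & bool | Mu of V.
Inductive tree := Leaf of leaf | Node of V & tree & tree.

Implicit Types (i j k : V) (t A B C : tree) (X Y Z W P : seq V).

Definition ind X i : int := (i \in X)%:Z.

(** The arrows X -> Y -> Z -> X, as a skew-symmetric matrix.  A side of a triangle
    is the list of the arcs along it: none for a boundary edge, two for the
    loop around the puncture, which stands for a plain and a notched radius. *)
Definition tri X Y Z i j : int :=
  (ind X i * ind Y j + ind Y i * ind Z j + ind Z i * ind X j)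
  - (ind X j * ind Y i + ind Y j * ind Z i + ind Z j * ind X i).

Definition lab t : seq V := if t is Node k _ _ then [:: k] else [::].
Fixpoint labs t : seq V :=
  if t is Node k l r then k :: labs l ++ labs r else [::].
Fixpoint leaves t : seq leaf :=
  match t with Leaf x => [:: x] | Node _ l r => leaves l ++ leaves r end.

Fixpoint al t j : int :=
  match t with
  | Leaf (Lam a _) => (j == a)%:Z
  | Leaf (Mu _) => 0
  | Node _ l r => al l j + al r j
  end.
Definition eps t j : int := if t is Leaf (Mu b) then (j == b)%:Z else 0.
(** The c-vector of a plain radius with [A] just before it and [B] just after it; a notched radius
    there has minus [chi B A]. *)
Definition chi A B j : int := al B j + eps A j - eps B j.

(** Both the exchange matrix and the matrix of c-vectors are sums of
    contributions of the triangles.  The triangle with top side [P] and legs [A]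
    and [B] contributes [nodeB P A B] and [nodeC P A B], the latter being its share
    in the shear coordinates of its three sides. *)
Definition nodeB P A B i j : int := tri (lab A) P (lab B) i j.
Definition nodeC P A B i j : int :=
  ind (lab B) i * (al B j + eps A j) - ind P i * chi A B j
  - ind (lab A) i * eps B j.

Fixpoint treeB t i j : int :=
  if t is Node k l r then nodeB [:: k] l r i j + treeB l i j + treeB r i j
  else 0.
Fixpoint treeC t i j : int :=
  if t is Node k l r then nodeC [:: k] l r i j + treeC l i j + treeC r i j
  else 0.

(** * Matrix mutation and flips in a quadrilateral *)

Definition mutB (b : V -> V -> int) k i j : int :=
  if (i == k) || (j == k) then - b i j
  else b i j + pos (b i k) * pos (b k j) - pos (b j k) * pos (b k i).
(** The rule for a green [k]: only vertices with arrows into [k] gain its c-vector. *)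
Definition mutC (b c : V -> V -> int) k i j : int :=
  if i == k then - c i j else c i j + pos (b i k) * c k j.

(** The sign alternative behind the choice of exchange relation: [u - v] is
    nonnegative only if [v = 0], and nonpositive only if [u = 0]. *)
Definition bal (u v : V -> int) : Prop :=
  ((forall j, v j = 0) /\ exists j, 0 < u j) \/
  ((forall j, u j = 0) /\ exists j, 0 < v j).

Lemma balC u v : bal u v -> bal v u.
Proof. by case=> ?; [right | left]. Qed.

Lemma bal_ge u v : bal u v -> (forall j, v j <= u j) -> forall j, v j = 0.
Proof. by case=> [[]//|[u0 [j vj]] /(_ j)]; rewrite u0; lia. Qed.

(** A flip of [k] in a quadrilateral with arrows X, Z -> k -> Y, W, where [ck] is
    the c-vector of [k].  The error [e] vanishes when [k] is green, and then this
    is mutation; keeping it makes the notion symmetric, as the inverse flip has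
    c-vector [- ck] and error [ck + e]. *)
Definition flip (b c b' c' : V -> V -> int) k (ck : V -> int) : Prop :=
  exists X Y Z W (rb rc : V -> V -> int) (gx gy gz gw e : V -> int),
  [/\ uniq (k :: X ++ Y ++ Z ++ W),
      forall i, [/\ rb i k = 0, rb k i = 0 & rc k i = 0],
      bal (fun j => ck j + e j) e,
      (forall i j, b i j = rb i j + tri X [:: k] Y i j + tri Z [:: k] W i j /\
        b' i j = rb i j + tri Y [:: k] Z i j + tri W [:: k] X i j) &
      forall i j,
       c i j = rc i j + ind X i * gx j + ind Y i * gy j + ind Z i * gz j
         + ind W i * gw j + ind [:: k] i * ck j /\
       c' i j = rc i j + ind X i * (gx j + ck j + e j) + ind Y i * (gy j - e j)
         + ind Z i * (gz j + ck j + e j) + ind W i * (gw j - e j)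
         - ind [:: k] i * ck j].

Variant one_hot X Y Z W k i : bool -> bool -> bool -> bool -> bool -> Type :=
  | HotX : one_hot X Y Z W k i true false false false false
  | HotY : one_hot X Y Z W k i false true false false false
  | HotZ : one_hot X Y Z W k i false false true false false
  | HotW : one_hot X Y Z W k i false false false true false
  | HotK : one_hot X Y Z W k i false false false false true
  | Cold : one_hot X Y Z W k i false false false false false.

Lemma one_hotP X Y Z W k i : uniq (k :: X ++ Y ++ Z ++ W) ->
  one_hot X Y Z W k i (i \in X) (i \in Y) (i \in Z) (i \in W) (i == k).
Proof.
have uqE s1 s2 : uniq (s1 ++ s2) -> i \in s1 -> i \in s2 -> false.
  rewrite cat_uniq => /and3P[_ /hasPn/(_ i) + _] i1 i2 => /(_ i2).
  by rewrite /= i1.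
rewrite /= !mem_cat !negb_or => /andP[/and4P[kX kY kZ kW] u].
have u2 : uniq (Y ++ Z ++ W) by move: u; rewrite cat_uniq => /and3P[].
have u3 : uniq (Z ++ W) by move: u2; rewrite cat_uniq => /and3P[].
have [->|_] := eqVneq i k.
  by rewrite (negbTE kX) (negbTE kY) (negbTE kZ) (negbTE kW); constructor.
have [iX|_] := boolP (i \in X).
  have := uqE _ _ u iX; rewrite !mem_cat.
  by do 3![case: (_ \in _) => [/(_ isT)//|]]; constructor.
have [iY|_] := boolP (i \in Y).
  have := uqE _ _ u2 iY; rewrite !mem_cat.
  by do 2![case: (_ \in _) => [/(_ isT)//|]]; constructor.
have [iZ|_] := boolP (i \in Z).
  have := uqE _ _ u3 iZ.
  by do 1![case: (_ \in _) => [/(_ isT)//|]]; constructor.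
by case: (i \in W); constructor.
Qed.

(** For nonnegative [ck] the sign alternative kills [e]. The sides are disjoint, so the positive
    parts of [b] at [k] are the indicators of X, Z and of Y, W, and both rules become a case check
    on the sides containing [i] and [j]. *)
Lemma flip_mut b c b' c' k ck : flip b c b' c' k ck ->
  (forall j, c k j = ck j) /\
  ((forall j, 0 <= ck j) -> forall i j, b' i j = mutB b k i j /\
                                       c' i j = mutC b c k i j).
Proof.
move=> [X [Y [Z [W [rb [rc [gx [gy [gz [gw [e [u kf bl hb hc]]]]]]]]]]]].
have uK := one_hotP k u.
have cE j : c k j = ck j.
  have [-> _] := hc k j; have [_ _ ->] := kf j.
  rewrite /ind inE; case: uK (eqxx k) => // _; lia.
split=> // ck0 i j.
have e0 : forall j, e j = 0 by apply: (bal_ge bl) => l; have := ck0 l; lia.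
have bik l : b l k = ind X l + ind Z l - ind Y l - ind W l.
  have [-> _] := hb l k; have [-> _ _] := kf l.
  rewrite /tri /ind !inE; case: uK (eqxx k) => // _.
  case: (one_hotP l u); lia.
have bki l : b k l = ind Y l + ind W l - ind X l - ind Z l.
  have [-> _] := hb k l; have [_ -> _] := kf l.
  rewrite /tri /ind !inE; case: uK (eqxx k) => // _.
  case: (one_hotP l u); lia.
have pik l : pos (ind X l + ind Z l - ind Y l - ind W l) = ind X l + ind Z l.
  by rewrite /ind; case: (one_hotP l u).
have pki l : pos (ind Y l + ind W l - ind X l - ind Z l) = ind Y l + ind W l.
  by rewrite /ind; case: (one_hotP l u).
have fi : i == k -> rb i j = 0 by move/eqP->; have [] := kf j.
have fj : j == k -> rb i j = 0 by move/eqP->; have [] := kf i.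
have gi : i == k -> rc i j = 0 by move/eqP->; have [] := kf j.
rewrite /mutB /mutC cE !bik !bki !pik !pki.
have [-> ->] := hb i j; have [-> ->] := hc i j; rewrite e0 /tri /ind !inE.
move: fi fj gi.
by case: (one_hotP i u); case: (one_hotP j u) => /=; lia.
Qed.

Lemma eq_bal u v u' v' : u =1 u' -> v =1 v' -> bal u v -> bal u' v'.
Proof.
move=> uE vE; case=> -[h [j hj]]; [left | right]; split.
- by move=> l; rewrite -vE.
- by exists j; rewrite -uE.
- by move=> l; rewrite -uE.
- by exists j; rewrite -vE.
Qed.

(** Shifting the names of the four sides by one step exchanges incoming and outgoing sides at [k],
    and with them the two halves of the sign alternative. *)
Lemma flip_sym b c b' c' k ck :
  flip b c b' c' k ck -> flip b' c' b c k (fun j => - ck j).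
Proof.
move=> [X [Y [Z [W [rb [rc [gx [gy [gz [gw [e [u kf bl hb hc]]]]]]]]]]]].
exists Y, Z, W, X, rb, rc, (fun j => gy j - e j), (fun j => gz j + ck j + e j),
  (fun j => gw j - e j), (fun j => gx j + ck j + e j), (fun j => e j + ck j).
split=> //.
- suff /perm_uniq <- : perm_eq (k :: X ++ Y ++ Z ++ W) (k :: Y ++ Z ++ W ++ X).
    by [].
  by rewrite perm_cons (perm_catC X) -!catA.
- by apply: eq_bal (balC bl) => j /=; lia.
- by move=> i j; have [-> ->] := hb i j; rewrite /tri; split; lia.
- by move=> i j; have [-> ->] := hc i j; split; ring.
Qed.

(** A flip is local: triangles without the side [k] can be added before and after. *)
Lemma flip_frame (rb0 rc0 b c b' c' b1 c1 b2 c2 : V -> V -> int) k ck :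
  flip b c b' c' k ck ->
  (forall i, [/\ rb0 i k = 0, rb0 k i = 0 & rc0 k i = 0]) ->
  (forall i j, [/\ b1 i j = b i j + rb0 i j, b2 i j = b' i j + rb0 i j,
                   c1 i j = c i j + rc0 i j & c2 i j = c' i j + rc0 i j]) ->
  flip b1 c1 b2 c2 k ck.
Proof.
move=> [X [Y [Z [W [rb [rc [gx [gy [gz [gw [e [u kf bl hb hc]]]]]]]]]]]] f0 hE.
exists X, Y, Z, W, (fun i j => rb i j + rb0 i j), (fun i j => rc i j + rc0 i j),
  gx, gy, gz, gw, e; split=> //.
- by move=> i; have [-> -> ->] := kf i; have [-> -> ->] := f0 i.
- by move=> i j; have [-> -> _ _] := hE i j; have [-> ->] := hb i j; split; ring.
- by move=> i j; have [_ _ -> ->] := hE i j; have [-> ->] := hc i j; split; ring.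
Qed.

(** * Consecutive boundary edges and the sign alternative *)

Definition isMu (x : leaf) := if x is Mu _ then true else false.
Definition isLam x := ~~ isMu x.
Definition flag (x : leaf) := if x is Lam _ f then f else false.
(** What is needed of two consecutive boundary edges: an edge [Mu] follows an edge
    [Lam], and an edge marked as having degree 4 follows an edge [Mu]. *)
Definition link x y := ~~ (isMu x && isMu y) && (flag y ==> isMu x).

Lemma al_ge0 t j : 0 <= al t j.
Proof. by elim: t => [[]//|k l + r] /=; lia. Qed.

Lemma eps_ge0 t j : 0 <= eps t j.
Proof. by case: t => [[]|]. Qed.

Lemma sorted_catW s1 s2 : sorted link (s1 ++ s2) ->
  sorted link s1 /\ sorted link s2.
Proof. by case/cat_sorted2. Qed.

(** A node has at least two boundary edges below it and no two consecutive ones are [Mu], so some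
    edge is [Lam]. *)
Lemma al_gt0 t : sorted link (leaves t) ->
  (exists b, t = Leaf (Mu b)) \/ (forall j, eps t j = 0) /\ exists j, 0 < al t j.
Proof.
elim: t => [[a f|b]|k l IHl r IHr] /= st; first 2 last.
- right; split=> //; have [/IHl sl /IHr sr] := sorted_catW st.
  case: sl => [[b lE]|[_ [j lj]]]; last first.
    by exists j; have := al_ge0 r j; lia.
  case: sr => [[b' rE]|[_ [j rj]]]; last first.
    by exists j; have := al_ge0 l j; lia.
  by move: st; rewrite lE rE.
- by right; split=> //; exists a; rewrite eqxx.
by left; exists b.
Qed.

Lemma eps_link1 A B b : sorted link (leaves A ++ leaves B) ->
  B = Leaf (Mu b) -> forall j, eps A j = 0.
Proof.
by move=> + Bb; rewrite Bb; case: A => [[a f|b']|] /=.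
Qed.

Lemma eps_link2 A B b : sorted link (leaves A ++ leaves B) ->
  A = Leaf (Mu b) -> forall j, eps B j = 0.
Proof.
by move=> + Bb; rewrite Bb; case: B => [[a f|b']|] /=.
Qed.

(** If [B] is a lone [Mu] edge, its neighbours are not, and only [eps B] survives; otherwise [eps B]
    vanishes and a [Lam] edge of [B] gives positivity. *)
Lemma bal3 A B C : sorted link (leaves A ++ leaves B ++ leaves C) ->
  bal (fun j => al B j + eps A j + eps C j) (eps B).
Proof.
move=> s3; have [_ sBC] := sorted_catW s3; have [sB _] := sorted_catW sBC.
have sAB : sorted link (leaves A ++ leaves B).
  by move: s3; rewrite catA => /sorted_catW[].
case: (al_gt0 sB) => [[b Bb]|[eB [j jB]]].
  right; split; last by exists b; rewrite Bb /= eqxx.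
  by move=> j; rewrite (eps_link1 sAB Bb) (eps_link2 sBC Bb) Bb.
by left; split=> //; exists j; have := eps_ge0 A j; have := eps_ge0 C j; lia.
Qed.

Lemma bal2l A B : sorted link (leaves A ++ leaves B) ->
  bal (fun j => al B j + eps A j) (eps B).
Proof.
move=> sAB; have [_ sB] := sorted_catW sAB.
case: (al_gt0 sB) => [[b Bb]|[eB [j jB]]].
  right; split; last by exists b; rewrite Bb /= eqxx.
  by move=> j; rewrite (eps_link1 sAB Bb) Bb.
by left; split=> //; exists j; have := eps_ge0 A j; lia.
Qed.

Lemma bal2r A B : sorted link (leaves A ++ leaves B) ->
  bal (fun j => al A j + eps B j) (eps A).
Proof.
move=> sAB; have [sA _] := sorted_catW sAB.
case: (al_gt0 sA) => [[b Bb]|[eB [j jB]]].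
  right; split; last by exists b; rewrite Bb /= eqxx.
  by move=> j; rewrite (eps_link2 sAB Bb) Bb.
by left; split=> //; exists j; have := eps_ge0 B j; lia.
Qed.

Lemma alE t j : al t j =
  \sum_(x <- leaves t) if x is Lam a _ then (j == a)%:Z else 0.
Proof.
elim: t => [[a f|b]|k l IHl r IHr] /=; last by rewrite big_cat IHl IHr.
  by rewrite big_seq1.
by rewrite big_seq1.
Qed.

Lemma al_leaves t t' : leaves t' = leaves t -> al t' =1 al t.
Proof. by move=> tE j; rewrite !alE tE. Qed.

Lemma lab_sub t : {subset lab t <= labs t}.
Proof. by case: t => // k l r i; rewrite !inE => ->. Qed.

Lemma ind0 X i : i \notin X -> ind X i = 0.
Proof. by rewrite /ind => /negbTE->. Qed.

Lemma node_free P l r k : k \notin P -> k \notin lab l -> k \notin lab r ->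
  forall i, [/\ nodeB P l r i k = 0, nodeB P l r k i = 0 & nodeC P l r k i = 0].
Proof.
move=> kP kl kr i.
by rewrite /nodeB /nodeC /tri !(ind0 kP) !(ind0 kl) !(ind0 kr); split; ring.
Qed.

Lemma notin_lab t k : k \notin labs t -> k \notin lab t.
Proof. by apply: contra; apply: lab_sub. Qed.

Lemma tree_free t k : k \notin labs t ->
  forall i, [/\ treeB t i k = 0, treeB t k i = 0 & treeC t k i = 0].
Proof.
elim: t => [x|p l IHl r IHr] /=; first by split.
rewrite inE mem_cat !negb_or => /and3P[kp kl kr] i.
have [-> -> ->] := IHl kl i; have [-> -> ->] := IHr kr i.
have [||| -> -> ->] := @node_free [:: p] l r k _ _ _ i; rewrite ?inE ?notin_lab //.
Qed.

(** The potential of a boundary edge which is the left or right leg of a triangle,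
    or lies between two consecutive plain radii. *)
Definition stL t : int := if t is Leaf x then (isMu x)%:Z else 0.
Definition stR t : int := if t is Leaf x then (flag x)%:Z else 0.
Definition stS t : int := if t is Leaf x then (isMu x || flag x)%:Z else 0.
Fixpoint phiT t : int :=
  if t is Node _ l r then stL l + stR r + phiT l + phiT r else 0.

(** In a rotation only the middle tree changes between being a left and a right leg; this bounds the
    cost. *)
Lemma st_diff t : stL t <= stR t + 1 /\ stR t <= stL t + 1.
Proof. by case: t => [[? []|?]|? ? ?]. Qed.

(** * Flips of arcs inside a tree *)

Definition phiN l r : int := stL l + stR r + phiT l + phiT r.
Definition forkB P l r i j : int := nodeB P l r i j + treeB l i j + treeB r i j.
Definition forkC P l r i j : int := nodeC P l r i j + treeC l i j + treeC r i j.

(** In the quadrilateral with sides [P], [A], [B], [C], the arc [k] passes from one diagonal to the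
    other; the error is [eps B]. *)
Lemma flip_rot P A B C k :
  uniq (k :: P ++ lab A ++ lab B ++ lab C) ->
  sorted link (leaves A ++ leaves B ++ leaves C) ->
  flip (fun i j => nodeB P A (Node k B C) i j + nodeB [:: k] B C i j)
       (fun i j => nodeC P A (Node k B C) i j + nodeC [:: k] B C i j)
       (fun i j => nodeB P (Node k A B) C i j + nodeB [:: k] A B i j)
       (fun i j => nodeC P (Node k A B) C i j + nodeC [:: k] A B i j)
       k (fun j => al B j + eps A j + eps C j - eps B j).
Proof.
move=> u s3.
exists P, (lab A), (lab B), (lab C), (fun _ _ => 0), (fun _ _ => 0),
  (fun j => - chi A (Node k B C) j), (fun _ => 0), (fun j => - eps C j),
  (fun j => al C j + eps B j), (eps B); split=> //.
- by apply: eq_bal (bal3 s3) => j /=; ring.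
- by move=> i j; rewrite /nodeB /tri /=; split; ring.
- by move=> i j; rewrite /nodeC /chi /=; split; ring.
Qed.

Lemma lab_subseq t : subseq (lab t) (labs t).
Proof. by case: t => //= k l r; rewrite eqxx sub0seq. Qed.

Lemma uniq_labs P A B C k s : perm_eq s (k :: P ++ labs A ++ labs B ++ labs C) ->
  uniq s -> uniq (k :: P ++ lab A ++ lab B ++ lab C).
Proof.
move=> /perm_uniq-> ; apply: subseq_uniq.
by rewrite /= eqxx !cat_subseq ?lab_subseq.
Qed.

Ltac count_perm :=
  apply/permP => ?; rewrite -?cats1 /=; do 4 rewrite ?count_cat /=; clear; lia.

(** The root is excluded because its quadrilateral is not contained in the tree. Keeping the root
    and the boundary word makes the step usable inside a larger tree. *)
Definition tree_step t k := uniq (labs t) -> sorted link (leaves t) ->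
  k \in labs t -> k \notin lab t ->
  exists t' ck, [/\ flip (treeB t) (treeC t) (treeB t') (treeC t') k ck,
    lab t' = lab t, leaves t' = leaves t, perm_eq (labs t') (labs t) &
    phiT t' <= phiT t + 1].

Lemma lab_node t t' : lab t' = lab t -> lab t <> [::] ->
  [/\ eps t' =1 eps t, stL t' = stL t, stR t' = stR t & stS t' = stS t].
Proof. by case: t t' => [x|k l r] [x'|k' l' r']. Qed.

Lemma node_step P l r k : tree_step l k -> tree_step r k ->
  uniq (P ++ labs l ++ labs r) -> sorted link (leaves l ++ leaves r) ->
  k \in labs l ++ labs r ->
  exists l' r' ck,
  [/\ flip (forkB P l r) (forkC P l r) (forkB P l' r') (forkC P l' r') k ck,
    leaves l' ++ leaves r' = leaves l ++ leaves r,
    perm_eq (labs l' ++ labs r') (labs l ++ labs r) &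
    phiN l' r' <= phiN l r + 1].
Proof.
move=> IHl IHr u slr klr.
have [sl sr] := sorted_catW slr.
have kP : k \notin P.
  move: u; rewrite cat_uniq => /and3P[_ /hasPn + _].
  by move=> /(_ _ klr).
have ulr : uniq (labs l ++ labs r) by move: u; rewrite cat_uniq => /and3P[].
have [ul ur] : uniq (labs l) /\ uniq (labs r).
  by move: ulr; rewrite cat_uniq => /and3P[].
have klrn : ~~ ((k \in labs l) && (k \in labs r)).
  move: ulr; rewrite cat_uniq => /and3P[_ /hasPn + _].
  by move=> h; apply/andP=> -[kl /h]; rewrite /= kl.
move: klr; rewrite mem_cat; have [kl _|kl /= kr] := boolP (k \in labs l).
  have kr : k \notin labs r by move: klrn; rewrite kl.
  have [kll|kll] := boolP (k \in lab l).
    case: l {IHl IHr} kll u slr sl ulr ul klrn kl => // k' A B.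
    rewrite inE => /eqP<- {k'} u slr sl ulr ul klrn kl.
    (* The root of the left leg undergoes the inverse rotation, hence [flip_sym] and the sign. *)
    exists A, (Node k B r), (fun j => - (al B j + eps A j + eps r j - eps B j)).
    split.
    + apply: (flip_frame (rb0 := fun i j => treeB A i j + treeB B i j + treeB r i j)
        (rc0 := fun i j => treeC A i j + treeC B i j + treeC r i j)
        (flip_sym (flip_rot (P := P) (A := A) (B := B) (C := r) (k := k) _ _))).
      * by apply: uniq_labs u; count_perm.
      * by rewrite catA.
      * move: ul; rewrite /= mem_cat negb_or => /andP[/andP[kA kB] _] i.
        have [-> -> ->] := tree_free kA i; have [-> -> ->] := tree_free kB i.
        by have [-> -> ->] := tree_free kr i.
      * by move=> i j; rewrite /forkB /forkC /=; split; ring.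
    + by rewrite /= catA.
    + by count_perm.
    + by rewrite /phiN /=; have := st_diff B; clear; lia.
  have [l' [ck [fl lE vE pE ph]]] := IHl ul sl kl kll.
  have ln : lab l <> [::] by case: (l) kl.
  have [eE lE1 lE2 lE3] := lab_node lE ln; have aE := al_leaves vE.
  exists l', r, ck; split.
  + apply: (flip_frame (rb0 := fun i j => nodeB P l r i j + treeB r i j)
      (rc0 := fun i j => nodeC P l r i j + treeC r i j) fl).
    * move=> i; have [-> -> ->] := tree_free kr i.
      by have [-> -> ->] := node_free kP kll (notin_lab kr) i.
    * move=> i j; rewrite /forkB /forkC /nodeB /nodeC /chi ?aE !eE lE; split; ring.
  + by rewrite vE.
  + by rewrite perm_cat2r.
  + by rewrite /phiN lE1; move: ph; clear; lia.
have [krr|krr] := boolP (k \in lab r).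
  case: r {IHl IHr} krr u slr sr ulr ur klrn kr => // k' B C.
  rewrite inE => /eqP<- {k'} u slr sr ulr ur klrn kr.
  exists (Node k l B), C, (fun j => al B j + eps l j + eps C j - eps B j).
  split.
  - apply: (flip_frame (rb0 := fun i j => treeB l i j + treeB B i j + treeB C i j)
      (rc0 := fun i j => treeC l i j + treeC B i j + treeC C i j)
      (flip_rot (P := P) (A := l) (B := B) (C := C) (k := k) _ _)).
    + by apply: uniq_labs u; count_perm.
    + by [].
    + move: ur; rewrite /= mem_cat negb_or => /andP[/andP[kB kC] _] i.
      have [-> -> ->] := tree_free kC i; have [-> -> ->] := tree_free kB i.
      by have [-> -> ->] := tree_free kl i.
    + by move=> i j; rewrite /forkB /forkC /=; split; ring.
  - by rewrite /= catA.
  - by count_perm.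
  - by rewrite /phiN /=; have := st_diff B; clear; lia.
have [r' [ck [fl lE vE pE ph]]] := IHr ur sr kr krr.
have ln : lab r <> [::] by case: (r) kr.
have [eE lE1 lE2 lE3] := lab_node lE ln; have aE := al_leaves vE.
exists l, r', ck; split.
- apply: (flip_frame (rb0 := fun i j => nodeB P l r i j + treeB l i j)
    (rc0 := fun i j => nodeC P l r i j + treeC l i j) fl).
  + move=> i; have [-> -> ->] := tree_free kl i.
    by have [-> -> ->] := node_free kP (notin_lab kl) krr i.
  + move=> i j; rewrite /forkB /forkC /nodeB /nodeC /chi ?aE !eE lE; split; ring.
- by rewrite vE.
- by rewrite perm_cat2l.
- by rewrite /phiN lE2; move: ph; clear; lia.
Qed.

Lemma tree_stepP t k : tree_step t k.
Proof.
elim: t => [x|p l IHl r IHr] // u s kt; rewrite inE => kp.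
move: kt; rewrite inE (negbTE kp) /= => klr.
have [l' [r' [ck [fl vE pE ph]]]] := node_step (P := [:: p]) IHl IHr u s klr.
by exists (Node p l' r'), ck; split; rewrite //= perm_cons.
Qed.


(** * States: triangulations of the punctured polygon *)

(** [Cyc nt s] has the radii listed in [s], all plain or all notched ([nt]), each
    followed by the tree up to the next radius.  [Dbl p q A B] has a single
    endpoint carrying the plain radius [p] and the notched radius [q]. *)
Inductive state :=
  | Cyc of bool & seq (V * tree)
  | Dbl of V & V & tree & tree.

(** The triangle with base the tree [x.1.2], left side the radius [x.1.1] and right
    side the radius [x.2]. *)
Definition capB (x : V * tree * V) i j : int :=
  tri (lab x.1.2) [:: x.1.1] [:: x.2] i j.
Definition capC (nt : bool) (x : V * tree * V) i j : int :=
  ind [:: x.1.1] i * (al x.1.2 j - eps x.1.2 j) + ind [:: x.2] i * eps x.1.2 j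
  + nt%:Z * (ind (lab x.1.2) i - ind [:: x.1.1] i - ind [:: x.2] i) * al x.1.2 j.

(** The triangles at the puncture; the rotation supplies each sector with its second radius,
    cyclically. *)
Definition caps (s : seq (V * tree)) := zip s (rot 1 (unzip1 s)).

Definition stB S i j : int :=
  match S with
  | Cyc nt s => \sum_(x <- caps s) (capB x i j + treeB x.1.2 i j)
  | Dbl p q A B => forkB [:: p; q] A B i j
  end.
Definition stC S i j : int :=
  match S with
  | Cyc nt s => \sum_(x <- caps s) (capC nt x i j + treeC x.1.2 i j)
  | Dbl p q A B => forkC [:: p; q] A B i j + ind [:: p] i * (al A j + al B j)
  end.
Definition slabs S : seq V :=
  match S with
  | Cyc nt s => flatten [seq x.1 :: labs x.2 | x <- s]
  | Dbl p q A B => [:: p; q] ++ labs A ++ labs B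
  end.
Definition sleaves S : seq leaf :=
  match S with
  | Cyc nt s => flatten [seq leaves x.2 | x <- s]
  | Dbl p q A B => leaves A ++ leaves B
  end.
(** The radii contribute minus their number if they are plain, -1 for [Dbl], and
    their number minus 2 if they are notched. *)
Definition phi S : int :=
  match S with
  | Cyc nt s => (if nt then (size s)%:Z - 2 else - (size s)%:Z) +
      \sum_(x <- s) (phiT x.2 + (if nt then 0 else stS x.2))
  | Dbl p q A B => - 1 + phiN A B
  end.
(** A single endpoint of radii is represented by [Dbl], never by [Cyc]. *)
Definition two_radii S := if S is Cyc nt s then (1 < size s)%N else true.

(** Boundary edges are only counted, since their order in [sleaves] depends on where the cycle is
    cut. *)
Definition next S k := exists S' ck,
  [/\ flip (stB S) (stC S) (stB S') (stC S') k ck,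
      perm_eq (slabs S') (slabs S),
      (forall a, count a (sleaves S') = count a (sleaves S)) /\ cycle link (sleaves S'),
      two_radii S' & phi S' <= phi S + 1].

(** * Flips of radii *)

Lemma flip_merge p A k B q : uniq (k :: [:: p] ++ lab A ++ lab B ++ [:: q]) ->
  sorted link (leaves A ++ leaves B) ->
  flip (fun i j => capB (p, A, k) i j + capB (k, B, q) i j)
       (fun i j => capC false (p, A, k) i j + capC false (k, B, q) i j)
       (fun i j => capB (p, Node k A B, q) i j + nodeB [:: k] A B i j)
       (fun i j => capC false (p, Node k A B, q) i j + nodeC [:: k] A B i j)
       k (chi A B) /\
  flip (fun i j => capB (p, Node k A B, q) i j + nodeB [:: k] A B i j)
       (fun i j => capC true (p, Node k A B, q) i j + nodeC [:: k] A B i j)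
       (fun i j => capB (p, A, k) i j + capB (k, B, q) i j)
       (fun i j => capC true (p, A, k) i j + capC true (k, B, q) i j)
       k (chi B A).
Proof.
move=> u s2; split.
(* The quadrilateral around [k] has sides [p], [A], [B], [q]; its other diagonal cuts [A] and [B]
   off from the puncture. *)
- exists [:: p], (lab A), (lab B), [:: q], (fun _ _ => 0), (fun _ _ => 0),
    (fun j => al A j - eps A j), (fun _ => 0), (fun _ => 0), (eps B), (eps B).
  split=> //.
  + by apply: eq_bal (bal2l s2) => j //; rewrite /chi; ring.
  + by move=> i j; rewrite /capB /nodeB /tri /=; split; ring.
  + by move=> i j; rewrite /capC /nodeC /chi /=; split; ring.
exists (lab A), (lab B), [:: q], [:: p], (fun _ _ => 0), (fun _ _ => 0),
  (fun j => - eps B j), (fun j => al B j + eps A j),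
  (fun j => - al A j - al B j), (fun _ => 0), (eps A).
split=> //.
- suff /perm_uniq -> : perm_eq (k :: lab A ++ lab B ++ [:: q] ++ [:: p])
      (k :: [:: p] ++ lab A ++ lab B ++ [:: q]) by [].
  by count_perm.
- by apply: eq_bal (bal2r s2) => j //; rewrite /chi; ring.
- by move=> i j; rewrite /capB /nodeB /tri /=; split; ring.
- by move=> i j; rewrite /capC /nodeC /chi /=; split; ring.
Qed.

Lemma indn i : ind [::] i = 0. Proof. by []. Qed.

Lemma ind2 k p i : k \notin [:: p] ->
  ind [:: p; k] i = ind [:: p] i + ind [:: k] i.
Proof.
rewrite inE /ind !inE; have [->|] := eqVneq i k; first by move/negbTE->.
by rewrite orbF addr0.
Qed.

Lemma ind2' k p i : k \notin [:: p] ->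
  ind [:: k; p] i = ind [:: p] i + ind [:: k] i.
Proof. by move/(ind2 i) <-; rewrite /ind !inE orbC. Qed.

(** Inside a digon the two triangles give opposite arrows between [p] and [k], which cancel, so the
    quadrilateral of [k] has two empty sides. The flip changes the tag of [k] and the endpoint it
    leaves from. *)
Lemma flip_close p A k B : uniq ([:: k; p] ++ labs A ++ labs B) ->
  sorted link (leaves A ++ leaves B) ->
  flip (stB (Cyc false [:: (p, A); (k, B)])) (stC (Cyc false [:: (p, A); (k, B)]))
       (stB (Dbl p k A B)) (stC (Dbl p k A B)) k (chi A B) /\
  flip (stB (Dbl k p A B)) (stC (Dbl k p A B))
    (stB (Cyc true [:: (p, A); (k, B)])) (stC (Cyc true [:: (p, A); (k, B)]))
    k (chi B A).
Proof.
move=> u s2.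
have [kp kA kB] : [/\ k \notin [:: p], k \notin labs A & k \notin labs B].
  by move: u; rewrite /= !inE mem_cat !negb_or => /andP[/and3P[-> -> ->]].
have u2 : uniq (k :: lab B ++ lab A).
  have : uniq (k :: labs B ++ labs A).
    have : perm_eq ([:: k; p] ++ labs A ++ labs B) (p :: k :: labs B ++ labs A).
      by count_perm.
    by move=> /perm_uniq; rewrite u => /esym /= /andP[].
  by apply: subseq_uniq; rewrite /= eqxx cat_subseq ?lab_subseq.
split.
- exists (lab B), (lab A), [::], [::],
    (fun i j => nodeB [:: p] A B i j + treeB A i j + treeB B i j),
    (fun i j => treeC A i j + treeC B i j
                + ind [:: p] i * (al A j - eps A j + eps B j)),
    (fun _ => 0), (fun _ => 0), (fun _ => 0), (fun _ => 0), (eps B).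
  split.
  + by rewrite !cats0.
  + move=> i; have [-> -> ->] := tree_free kA i; have [-> -> ->] := tree_free kB i.
    have [-> -> _] := node_free kp (notin_lab kA) (notin_lab kB) i.
    by rewrite (ind0 kp); split; ring.
  + by apply: eq_bal (bal2l s2) => j //; rewrite /chi; ring.
  + move=> i j; rewrite /stB /caps /= !big_cons big_nil.
    by rewrite /capB /forkB /nodeB /tri /= !(ind2 _ kp) !indn; split; ring.
  + move=> i j; rewrite /stC /caps /= !big_cons big_nil.
    by rewrite /capC /forkC /nodeC /chi /= !(ind2 _ kp) !indn; split; ring.
exists (lab A), [::], [::], (lab B),
  (fun i j => nodeB [:: p] A B i j + treeB A i j + treeB B i j),
  (fun i j => treeC A i j + treeC B i j - ind [:: p] i * chi A B j),
  (fun j => - eps B j), (fun _ => 0), (fun _ => 0),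
  (fun j => al B j + eps A j), (eps A).
split.
- by move: u2; rewrite /= mem_cat uniq_catC orbC -mem_cat.
- move=> i; have [-> -> ->] := tree_free kA i; have [-> -> ->] := tree_free kB i.
  have [-> -> _] := node_free kp (notin_lab kA) (notin_lab kB) i.
  by rewrite (ind0 kp); split; ring.
- by apply: eq_bal (bal2r s2) => j //; rewrite /chi; ring.
- move=> i j; rewrite /stB /caps /= !big_cons big_nil.
  by rewrite /capB /forkB /nodeB /tri /= !(ind2' _ kp) !indn; split; ring.
move=> i j; rewrite /stC /caps /= !big_cons big_nil.
by rewrite /capC /forkC /nodeC /chi /= !(ind2' _ kp) !indn; split; ring.
Qed.

(** * Triangles away from the flipped arc, and cyclic rotation of states *)

Definition all_free nt k (z : seq (V * tree * V)) :=
  forall i, [/\ \sum_(x <- z) (capB x i k + treeB x.1.2 i k) = 0,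
    \sum_(x <- z) (capB x k i + treeB x.1.2 k i) = 0 &
    \sum_(x <- z) (capC nt x k i + treeC x.1.2 k i) = 0].

Lemma cap_free nt k x : k != x.1.1 -> k != x.2 -> k \notin lab x.1.2 ->
  forall i, [/\ capB x i k = 0, capB x k i = 0 & capC nt x k i = 0].
Proof.
have inE1 (a : V) : (k \in [:: a]) = (k == a) by rewrite inE.
rewrite -!inE1 => k1 k2 kx i.
by rewrite /capB /capC /tri !(ind0 k1) !(ind0 k2) !(ind0 kx); split; ring.
Qed.

Lemma caps_free nt k p q t s : k != p -> k != q -> k \notin labs t ->
  k \notin slabs (Cyc nt s) ->
  all_free nt k (zip ((q, t) :: s) (rcons (unzip1 s) p)).
Proof.
elim: s q t => [|[r t'] s IHs] q t kp kq kt /=; rewrite ?inE ?mem_cat ?negb_or.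
  move=> _ i; rewrite !big_cons !big_nil.
  have [-> -> ->] := cap_free nt (x := (q, t, p)) kq kp (notin_lab kt) i.
  by have [-> -> ->] := tree_free kt i.
move=> /and3P[kr kt' ks] i; rewrite !big_cons /=.
have [-> -> ->] := IHs r t' kp kr kt' ks i.
have [-> -> ->] := cap_free nt (x := (q, t, r)) kq kr (notin_lab kt) i.
by have [-> -> ->] := tree_free kt i.
Qed.

Lemma zip_rot (S T : Type) n (s : seq S) (t : seq T) : size s = size t ->
  zip (rot n s) (rot n t) = rot n (zip s t).
Proof.
move=> st; rewrite /rot zip_cat ?size_drop ?st //; congr (_ ++ _).
  by elim: n s t {st} => [|n IHn] [|x s] [|y t] //=; case: (drop _ _).
by elim: n s t {st} => [|n IHn] [|x s] [|y t] //=; rewrite IHn.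
Qed.

Lemma caps_rot n s : caps (rot n s) = rot n (caps s).
Proof.
by rewrite /caps /unzip1 map_rot rot_rot zip_rot // size_rot size_map.
Qed.

Lemma big_rot (T : Type) n (s : seq T) (F : T -> int) :
  \sum_(x <- rot n s) F x = \sum_(x <- s) F x.
Proof. by rewrite big_cat /= addrC -big_cat /= cat_take_drop. Qed.

Lemma cycle_catC s1 s2 : cycle link (s1 ++ s2) = cycle link (s2 ++ s1).
Proof. by rewrite -(rot_size_cat s1) rot_cycle. Qed.

Lemma flatten_rot (T : Type) n (f : V * tree -> seq T) s :
  let s1 := flatten [seq f x | x <- take n s] in
  let s2 := flatten [seq f x | x <- drop n s] in
  flatten [seq f x | x <- rot n s] = s2 ++ s1 /\
  flatten [seq f x | x <- s] = s1 ++ s2.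
Proof.
by split; rewrite ?/rot ?map_cat ?flatten_cat // -flatten_cat -map_cat cat_take_drop.
Qed.

(** No radius of a [Cyc] state is distinguished; this allows moving any sector to the front. *)
Lemma cyc_rot nt n s : [/\
  stB (Cyc nt (rot n s)) =2 stB (Cyc nt s),
  stC (Cyc nt (rot n s)) =2 stC (Cyc nt s),
  perm_eq (slabs (Cyc nt (rot n s))) (slabs (Cyc nt s)),
  (forall a, count a (sleaves (Cyc nt (rot n s))) = count a (sleaves (Cyc nt s))) /\
  cycle link (sleaves (Cyc nt (rot n s))) = cycle link (sleaves (Cyc nt s)) &
  phi (Cyc nt (rot n s)) = phi (Cyc nt s)].
Proof.
rewrite /stB /stC /phi caps_rot big_rot size_rot; split=> // [i j|i j||].
- by rewrite big_rot.
- by rewrite big_rot.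
- have [/= e1 e2] := flatten_rot n (fun x => x.1 :: labs x.2) s.
  by rewrite /slabs e1 e2 perm_catC.
have [/= e1 e2] := flatten_rot n (fun x => leaves x.2) s.
rewrite /sleaves e1 e2; split; last exact: cycle_catC.
by move=> a; rewrite !count_cat addnC.
Qed.

Lemma next_rot nt n s k : next (Cyc nt (rot n s)) k -> next (Cyc nt s) k.
Proof.
have [hB hC hl [hv hc] hp] := cyc_rot nt n s.
move=> [S' [ck [fl pl [pv cv] b2 ph]]]; exists S', ck; split=> //.
- apply: (flip_frame (rb0 := fun _ _ => 0) (rc0 := fun _ _ => 0) fl) => // i j.
  by rewrite -hB -hC !addr0.
- exact: perm_trans pl hl.
- by split=> // a; rewrite pv hv.
- by rewrite -hp.
Qed.

Definition inv S := [/\ uniq (slabs S), cycle link (sleaves S) & two_radii S].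

Lemma inv_rot nt n s : inv (Cyc nt s) -> inv (Cyc nt (rot n s)).
Proof.
have [hB hC hl [hv hc] hp] := cyc_rot nt n s.
by rewrite /inv /two_radii size_rot hc (perm_uniq hl).
Qed.

Lemma st_bounds t :
  (0 <= stL t /\ stL t <= stS t) /\ (0 <= stR t /\ stR t <= stS t) /\
  stS t <= 1.
Proof. by case: t => [[? []|?]|? ? ?]. Qed.

Definition rest p q C (s : seq (V * tree)) := zip ((q, C) :: s) (rcons (unzip1 s) p).

Lemma caps2 p A k B s : caps ((p, A) :: (k, B) :: s) =
  ((p, A), k) :: rest p k B s.
Proof. by rewrite /caps [unzip1 _]/= rot1_cons. Qed.

Lemma rest_cons p q C r C' s :
  rest p q C ((r, C') :: s) = ((q, C), r) :: rest p r C' s.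
Proof. by []. Qed.

Lemma cycle_link_sorted s : cycle link s -> sorted link s.
Proof. by case: s => //= x s; rewrite rcons_path => /andP[]. Qed.

(** * Existence of a flip at every arc *)

Section Step.
Variables (nt : bool) (p k q : V) (A B C : tree) (s : seq (V * tree)).
(** In [S0] the arc [k] is a radius; in [S1] it is the root of the tree that joins the two
    sectors. *)
Let S0 := Cyc nt ((p, A) :: (k, B) :: (q, C) :: s).
Let S1 := Cyc nt ((p, Node k A B) :: (q, C) :: s).

Lemma perm_split : perm_eq (slabs S1) (slabs S0).
Proof. by rewrite /S0 /S1 /slabs; count_perm. Qed.

Lemma sleaves_split : sleaves S1 = sleaves S0.
Proof. by rewrite /= -!catA. Qed.

(** The radius lost or gained changes the potential by 1; the boundary terms of [A] and [B] move it
    the other way, each by 0 or 1. *)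
Lemma phi_split : phi S1 <= phi S0 + 1 /\ phi S0 <= phi S1 + 1.
Proof.
rewrite /S0 /S1 /phi !big_cons /=.
move: (\sum_(x <- s) _) => x.
have := st_bounds A; have := st_bounds B.
by case: nt; clear; lia.
Qed.

Lemma flip_split : uniq (slabs S0) -> cycle link (sleaves S0) ->
  if nt then flip (stB S1) (stC S1) (stB S0) (stC S0) k (chi B A)
  else flip (stB S0) (stC S0) (stB S1) (stC S1) k (chi A B).
Proof.
move=> u cy.
have uk : uniq (k :: ([:: p] ++ labs A ++ labs B ++ [:: q])
                 ++ labs C ++ slabs (Cyc nt s)).
  have /perm_uniq <- : perm_eq (slabs S0) (k :: ([:: p] ++ labs A ++ labs B ++ [:: q])
                 ++ labs C ++ slabs (Cyc nt s)) by rewrite /S0 /slabs; count_perm.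
  by [].
have [[kp kq] [kA kB kC] ks] : [/\ k != p /\ k != q,
    [/\ k \notin labs A, k \notin labs B & k \notin labs C] &
    k \notin slabs (Cyc nt s)].
  move: uk => /andP[+ _]; rewrite !mem_cat !inE !negb_or.
  by move=> /andP[/and4P[-> -> -> ->] /andP[-> ->]].
have u2 : uniq (k :: [:: p] ++ lab A ++ lab B ++ [:: q]).
  have : uniq (k :: [:: p] ++ labs A ++ labs B ++ [:: q]).
    by move: uk; rewrite -[k :: _ ++ _]cat_cons cat_uniq => /andP[].
  by apply: subseq_uniq; rewrite /= !eqxx !cat_subseq ?lab_subseq //= eqxx.
have s2 : sorted link (leaves A ++ leaves B).
  have : sorted link (sleaves S0) by apply: cycle_link_sorted.
  by rewrite /= catA => /sorted_catW[].
have [fl1 fl2] := flip_merge u2 s2.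
have rfree := caps_free kp kq kC ks.
pose rb i j := treeB A i j + treeB B i j
  + \sum_(x <- rest p q C s) (capB x i j + treeB x.1.2 i j).
pose rc i j := treeC A i j + treeC B i j
  + \sum_(x <- rest p q C s) (capC nt x i j + treeC x.1.2 i j).
have free i : [/\ rb i k = 0, rb k i = 0 & rc k i = 0].
  rewrite /rb /rc; have [-> -> ->] := rfree i.
  by have [-> -> ->] := tree_free kA i; have [-> -> ->] := tree_free kB i.
have eqs i j : [/\
  stB S0 i j = capB (p, A, k) i j + capB (k, B, q) i j + rb i j,
  stB S1 i j = capB (p, Node k A B, q) i j + nodeB [:: k] A B i j + rb i j,
  stC S0 i j = capC nt (p, A, k) i j + capC nt (k, B, q) i j + rc i j &
  stC S1 i j = capC nt (p, Node k A B, q) i j + nodeC [:: k] A B i j + rc i j].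
  rewrite /S0 /S1 /stB /stC !caps2 rest_cons !big_cons /=.
  by rewrite /rb /rc; split; ring.
move: rc rb free eqs fl1 fl2; rewrite /S0 /S1.
case: (nt) => rc rb free eqs fl1 fl2.
- by apply: (flip_frame fl2 free) => i j; have [] := eqs i j.
- by apply: (flip_frame fl1 free) => i j; have [] := eqs i j.
Qed.

Lemma next_merge : inv S0 -> next S0 k.
Proof.
move=> [u cy _]; have fl := flip_split u cy; have [ph _] := phi_split.
have perm := perm_split; have lE := sleaves_split.
move: fl ph perm lE; rewrite /S0 /S1; case: (nt) => fl ph perm lE.
- by exists (Cyc true ((p, Node k A B) :: (q, C) :: s)), (fun j => - chi B A j);
    split; rewrite ?lE //; exact: flip_sym.
- by exists (Cyc false ((p, Node k A B) :: (q, C) :: s)), (chi A B);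
    split; rewrite ?lE.
Qed.

Lemma next_split : inv S1 -> next S1 k.
Proof.
move=> [u cy _]; have [_ ph] := phi_split.
have perm := perm_split; have lE := sleaves_split.
rewrite (perm_uniq perm) lE in u cy.
have fl := flip_split u cy; rewrite perm_sym in perm.
move: fl ph perm lE; rewrite /S0 /S1; case: (nt) => fl ph perm lE.
- by exists (Cyc true ((p, A) :: (k, B) :: (q, C) :: s)), (chi B A);
    split; rewrite ?lE.
- by exists (Cyc false ((p, A) :: (k, B) :: (q, C) :: s)), (fun j => - chi A B j);
    split; rewrite ?lE //; exact: flip_sym.
Qed.

Lemma next_close : inv (Cyc nt [:: (p, A); (k, B)]) ->
  next (Cyc nt [:: (p, A); (k, B)]) k.
Proof.
move=> [u cy _].
have cyAB : cycle link (leaves A ++ leaves B) by move: cy; rewrite /= cats0.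
have s2 := cycle_link_sorted cyAB.
have pE x y : perm_eq ([:: x; y] ++ labs A ++ labs B) (slabs (Cyc nt [:: (x, A); (y, B)])).
  by rewrite /=; count_perm.
have pE' : perm_eq ([:: k; p] ++ labs A ++ labs B) (slabs (Cyc nt [:: (p, A); (k, B)])).
  by rewrite /=; count_perm.
have u' : uniq ([:: k; p] ++ labs A ++ labs B) by rewrite (perm_uniq pE').
have [fl1 fl2] := flip_close u' s2.
have := st_bounds A; have := st_bounds B.
case: (nt) cy u pE pE' => cy u pE pE' bB bA.
- exists (Dbl k p A B), (fun j => - chi B A j); split=> //.
  + exact: flip_sym.
  + by rewrite /= cats0.
  + by rewrite /phi !big_cons big_nil /phiN /=; move: bA bB; clear; lia.
- exists (Dbl p k A B), (chi A B); split=> //.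
  + exact: pE.
  + by rewrite /= cats0.
  + by rewrite /phi !big_cons big_nil /phiN /=; move: bA bB; clear; lia.
Qed.

End Step.

Lemma next_open p k A B : inv (Dbl p k A B) ->
  next (Dbl p k A B) p /\ next (Dbl p k A B) k.
Proof.
move=> [u cy _]; have s2 := cycle_link_sorted cy.
have u' : uniq ([:: k; p] ++ labs A ++ labs B).
  suff /perm_uniq <- : perm_eq (slabs (Dbl p k A B)) ([:: k; p] ++ labs A ++ labs B) by [].
  by rewrite /=; count_perm.
have := st_bounds A; have := st_bounds B => bB bA; split.
- have [_ fl] := flip_close u s2.
  exists (Cyc true [:: (k, A); (p, B)]), (chi B A); split=> //.
  + by rewrite /=; count_perm.
  + by rewrite /= cats0.
  + by rewrite /phi !big_cons big_nil /phiN /=; move: bA bB; clear; lia.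
have [fl _] := flip_close u' s2.
exists (Cyc false [:: (p, A); (k, B)]), (fun j => - chi A B j); split=> //.
- exact: flip_sym.
- by rewrite /=; count_perm.
- by rewrite /= cats0.
- by rewrite /phi !big_cons big_nil /phiN /=; move: bA bB; clear; lia.
Qed.

Lemma next_inner_dbl p q A B k : inv (Dbl p q A B) ->
  k \in labs A ++ labs B -> next (Dbl p q A B) k.
Proof.
move=> [u cy _] kAB; have s2 := cycle_link_sorted cy.
have [A' [B' [ck [fl lE pE ph]]]] :=
  node_step (@tree_stepP A k) (@tree_stepP B k) u s2 kAB.
exists (Dbl p q A' B'), ck; split=> //.
- apply: (flip_frame (rb0 := fun _ _ => 0)
    (rc0 := fun i j => ind [:: p] i * (al A j + al B j)) fl).
  + move=> i; split=> //; rewrite ind0 ?mul0r // inE; apply: contraTneq kAB => ->.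
    by move: u; rewrite /= inE negb_or => /andP[/andP[_ +] _].
  + move=> i j; rewrite /stB /stC !addr0; split=> //.
    (* The tag term of [Dbl] depends only on the boundary word, which is unchanged. *)
    by congr (_ + _ * _); rewrite !alE -!big_cat lE.
- by rewrite !perm_cons.
- by rewrite /= lE.
- by rewrite /phi; move: ph; clear; lia.
Qed.

Lemma next_inner nt p t s k : inv (Cyc nt ((p, t) :: s)) ->
  k \in labs t -> k \notin lab t -> next (Cyc nt ((p, t) :: s)) k.
Proof.
move=> [u cy b2] kt ktl.
have [ut st] : uniq (labs t) /\ sorted link (leaves t).
  split; first by move: u; rewrite /= cat_uniq => /andP[_ /and3P[]].
  by have := cycle_link_sorted cy; rewrite /= => /sorted_catW[].
have [t' [ck [fl lE vE pE ph]]] := tree_stepP ut st kt ktl.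
have ln : lab t <> [::] by case: (t) kt.
have [eE lE1 lE2 lE3] := lab_node lE ln; have aE := al_leaves vE.
exists (Cyc nt ((p, t') :: s)), ck; split=> //.
- have kns : k \notin p :: slabs (Cyc nt s).
    suff : uniq (labs t ++ p :: slabs (Cyc nt s)).
      by rewrite cat_uniq => /and3P[_ /hasPn h _]; apply/negP => /h /=; rewrite kt.
    suff /perm_uniq <- : perm_eq (slabs (Cyc nt ((p, t) :: s)))
        (labs t ++ p :: slabs (Cyc nt s)) by [].
    by rewrite /=; count_perm.
  case: s b2 kns {u cy} => [//|[q C] s] _.
  rewrite /= !inE mem_cat !negb_or => /and4P[kp kq kC ks].
  have rfree := caps_free kp kq kC ks.
  apply: (flip_frame (rb0 := fun i j => capB (p, t, q) i j
    + \sum_(x <- rest p q C s) (capB x i j + treeB x.1.2 i j))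
    (rc0 := fun i j => capC nt (p, t, q) i j
    + \sum_(x <- rest p q C s) (capC nt x i j + treeC x.1.2 i j)) fl).
  + move=> i; have [-> -> ->] := cap_free nt (x := (p, t, q)) kp kq ktl i.
    by have [-> -> ->] := rfree nt i.
  + move=> i j; rewrite /stB /stC !caps2 !big_cons /capB /capC /= lE aE eE.
    by split; ring.
- by rewrite /= perm_cons perm_cat2r.
- by rewrite /= vE.
- by rewrite /phi !big_cons /= lE3; move: ph; clear; case: (nt); lia.
Qed.

Lemma slabs_split nt s k : k \in slabs (Cyc nt s) ->
  exists s1 p t s2, s = s1 ++ (p, t) :: s2 /\ k \in p :: labs t.
Proof.
elim: s => [//|[p t] s IHs] /=; rewrite -cat_cons mem_cat => /orP[kt|/IHs].
  by exists [::], p, t, s.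
by move=> [s1 [q [t' [s2 [-> kt]]]]]; exists ((p, t) :: s1), q, t', s2.
Qed.

Lemma next_cat nt s1 s2 k : inv (Cyc nt (s1 ++ s2)) ->
  (inv (Cyc nt (s2 ++ s1)) -> next (Cyc nt (s2 ++ s1)) k) ->
  next (Cyc nt (s1 ++ s2)) k.
Proof.
move=> /(inv_rot (size s1)) i1 h; apply: (@next_rot _ (size s1)).
by move: i1 h; rewrite rot_size_cat => i1; apply.
Qed.

(** With its sector rotated to the front, [k] is the radius itself, the root of the tree, whose flip
    adds a radius, or an inner arc. *)
Lemma nextP S k : inv S -> k \in slabs S -> next S k.
Proof.
case: S => [nt s|p q A B] iS; last first.
  rewrite /slabs mem_cat !inE; have [h1 h2] := next_open iS.
  by case/orP=> [/orP[/eqP->|/eqP->]|kAB] //; exact: next_inner_dbl.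
move=> /slabs_split[s1 [p [t [s2 [sE kt]]]]]; rewrite {}sE in iS *.
apply: (next_cat iS) => {iS} /=; move: (s2 ++ s1) => {s1 s2} s iS.
have [kp|kp] := eqVneq k p.
  (* The last sector is moved to the front, so that [k] becomes the second radius. *)
  rewrite {}kp {kt} in iS *; case/lastP: s iS => [[]//|s [q C]].
  rewrite -cats1 -cat_cons => iS; apply: (next_cat iS) => {iS} /=.
  by case: s => [|[r D] s]; [exact: next_close | exact: next_merge].
move: kt; rewrite inE (negbTE kp) /= => kt.
have [ktl|ktl] := boolP (k \in lab t); last exact: next_inner.
case: t kt ktl iS => //= k' A B _; rewrite inE => /eqP<-.
by case: s => [[]//|[q C] s]; exact: next_split.
Qed.

(** * States without green arcs *)

Definition all_red S := forall k, k \in slabs S -> forall j, stC S k j <= 0.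

(** Read off from the flip at [k]: [flip_mut] identifies row [k] with [ck]. *)
Lemma stC_radius nt p A k B s j : inv (Cyc nt ((p, A) :: (k, B) :: s)) ->
  stC (Cyc nt ((p, A) :: (k, B) :: s)) k j =
  if nt then - chi B A j else chi A B j.
Proof.
case: s => [|[q C] s] [u cy _]; last first.
  have := flip_split u cy; case: (nt) => fl.
    by have [-> _] := flip_mut (flip_sym fl).
  by have [-> _] := flip_mut fl.
have s2 : sorted link (leaves A ++ leaves B).
  by have := cycle_link_sorted cy; rewrite /= cats0.
have u' : uniq ([:: k; p] ++ labs A ++ labs B).
  suff /perm_uniq -> : perm_eq ([:: k; p] ++ labs A ++ labs B)
    (slabs (Cyc nt [:: (p, A); (k, B)])) by [].
  by rewrite /=; count_perm.
have [fl1 fl2] := flip_close u' s2; case: (nt).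
  by have [-> _] := flip_mut (flip_sym fl2).
by have [-> _] := flip_mut fl1.
Qed.

Lemma red_rot nt s1 s2 : all_red (Cyc nt (s1 ++ s2)) -> all_red (Cyc nt (s2 ++ s1)).
Proof.
have [_ hC hl _ _] := cyc_rot nt (size s1) (s1 ++ s2).
rewrite rot_size_cat in hC hl.
by move=> h k kin j; rewrite hC; apply: h; rewrite -(perm_mem hl).
Qed.

Lemma inv_cat nt s1 s2 : inv (Cyc nt (s1 ++ s2)) -> inv (Cyc nt (s2 ++ s1)).
Proof. by move=> /(inv_rot (size s1)); rewrite rot_size_cat. Qed.

Lemma mu_of_chi A B : sorted link (leaves B) ->
  (forall j, chi A B j <= 0) -> exists b, B = Leaf (Mu b).
Proof.
move=> /al_gt0[//|[e0 [j aj]]] /(_ j); rewrite /chi e0.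
by have := eps_ge0 A j; lia.
Qed.

Lemma red_plain_head p A k B s : inv (Cyc false ((p, A) :: (k, B) :: s)) ->
  all_red (Cyc false ((p, A) :: (k, B) :: s)) -> exists b, B = Leaf (Mu b).
Proof.
move=> i red; apply: (@mu_of_chi A).
  by case: i => _ /cycle_link_sorted + _; rewrite /= catA => /sorted_catW[/sorted_catW[]].
move=> j; rewrite -(@stC_radius false p A k B s j i); apply: red.
by rewrite /= !inE mem_cat inE eqxx !orbT.
Qed.

(** Each radius would be followed by a lone [Mu] edge, making two [Mu] edges consecutive. *)
Lemma not_red_plain s : inv (Cyc false s) -> ~ all_red (Cyc false s).
Proof.
case: s => [[]//|[p A] [[]//|[k B] s]] i red.
have [b Bb] := red_plain_head i red.
have i' := inv_cat (s1 := [:: (p, A)]) i.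
have red' := red_rot (s1 := [:: (p, A)]) red.
case: s => [|[q C] s] in i red i' red' *.
  have [b' Ab] := red_plain_head i' red'.
  by case: i => _; rewrite Ab Bb.
have [b' Cb] := red_plain_head i' red'.
by case: i' => _ /cycle_link_sorted; rewrite Cb Bb.
Qed.

Lemma nodeC_right P A j B C x : j \notin P -> j \notin labs A ->
  j \notin labs B -> j \notin labs C ->
  forkC P A (Node j B C) j x = al B x + eps A x + eps C x - eps B x.
Proof.
move=> jP jA jB jC; rewrite /forkC /nodeC /chi /=.
have [_ _ ->] := tree_free jA x; have [_ _ ->] := tree_free jB x.
have [_ _ ->] := tree_free jC x.
rewrite (ind0 jP) (ind0 (notin_lab jA)) /nodeC (ind0 (notin_lab jB)).
rewrite (ind0 (notin_lab jC)) /chi /ind inE eqxx /=; ring.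
Qed.

(** At coordinate [b] the term [eps A] is 1, while [B] follows a [Mu] edge, so it is not one itself
    and [eps B] vanishes. *)
Lemma red_right A j B C b : A = Leaf (Mu b) ->
  sorted link (leaves A ++ leaves (Node j B C)) ->
  ~ forall x, al B x + eps A x + eps C x - eps B x <= 0.
Proof.
move=> -> /= s2 /(_ b); have := al_ge0 B b; have := eps_ge0 C b.
case: B s2 => [[a f|b']|k l r] //=; rewrite ?eqxx; lia.
Qed.

(** Redness of the plain radius makes [A] a lone [Mu] edge. If [B] is a leaf, there are too few
    [Lam] edges; otherwise [red_right] applies to its root. *)
Lemma not_red_dbl p q A B : inv (Dbl p q A B) ->
  (2 < count isLam (sleaves (Dbl p q A B)))%N -> ~ all_red (Dbl p q A B).
Proof.
move=> [u cy _] cl red.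
have s2 := cycle_link_sorted cy; have [sA sB] := sorted_catW s2.
have [b Ab] : exists b, A = Leaf (Mu b).
  apply: (@mu_of_chi B) => // j.
  have u' : uniq ([:: p; q] ++ labs A ++ labs B) by [].
  have [_ fl] := flip_close u' s2; have [<- _] := flip_mut fl.
  by apply: red; rewrite inE eqxx.
case: B => [[a f|b']|j B C] in u cy cl red s2 sB *.
- by move: cl; rewrite Ab.
- by move: s2; rewrite Ab.
apply: (red_right Ab s2) => x.
have : j \notin [:: p; q] ++ labs A ++ labs B ++ labs C.
  have : uniq (j :: [:: p; q] ++ labs A ++ labs B ++ labs C).
    suff /perm_uniq <- : perm_eq (slabs (Dbl p q A (Node j B C)))
       (j :: [:: p; q] ++ labs A ++ labs B ++ labs C) by [].
    by rewrite /=; count_perm.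
  by case/andP.
rewrite mem_cat negb_or => /andP[jp]; rewrite !mem_cat !negb_or => /and3P[jA jB jC].
rewrite -(nodeC_right x jp jA jB jC).
have : stC (Dbl p q A (Node j B C)) j x <= 0.
  by apply: red; rewrite /= !(inE, mem_cat) eqxx !orbT.
by rewrite /stC ind0 ?mul0r ?addr0 //; move: jp; rewrite !inE negb_or => /andP[].
Qed.

(** The legs of an ear come in the opposite order to the initial one: the ear has moved on by one
    boundary edge. *)
Definition final t :=
  match t with
  | Leaf (Lam _ f) => ~~ f
  | Node _ (Leaf (Mu _)) (Leaf (Lam _ _)) => true
  | _ => false
  end.
Definition final_flag t :=
  match t with
  | Leaf (Lam _ f) => true
  | Node _ (Leaf (Mu _)) (Leaf (Lam _ _)) => true
  | _ => false
  end.

Lemma red_notched_head p A k B s :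
  inv (Cyc true ((p, A) :: (k, B) :: s)) ->
  all_red (Cyc true ((p, A) :: (k, B) :: s)) -> final_flag A.
Proof.
move=> i red; have [u /cycle_link_sorted cy _] := i.
have sAB : sorted link (leaves A ++ leaves B).
  by move: cy; rewrite /= catA => /sorted_catW[].
have nA b : A <> Leaf (Mu b).
  move=> Ab; have kin : k \in slabs (Cyc true ((p, A) :: (k, B) :: s)).
    by rewrite /= !inE mem_cat inE eqxx !orbT.
  have := red k kin b; rewrite (stC_radius b i) /chi (eps_link2 sAB Ab) Ab /= eqxx.
  by [].
case: A => [[a f|b]|j A C] in i red u cy sAB nA *; first by [].
  by case: (nA b).
have [sA _] := sorted_catW sAB; have /= [sA1 sA2] := sorted_catW sA.
have [b Ab] : exists b, A = Leaf (Mu b).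
  (* The flip turning the root [j] into a radius shows that its c-vector is [chi C A]. *)
  apply: (@mu_of_chi C) => // x.
  have : stC (Cyc true ((p, Node j A C) :: (k, B) :: s)) j x <= 0.
    by apply: red; rewrite /= !inE eqxx !orbT.
  have u' : uniq (slabs (Cyc true ((p, A) :: (j, C) :: (k, B) :: s))).
    by rewrite -(perm_uniq (perm_split true p j k A C B s)).
  have cy' : cycle link (sleaves (Cyc true ((p, A) :: (j, C) :: (k, B) :: s))).
    by rewrite -(sleaves_split true p j k A C B s); case: i.
  by have [-> _] := flip_mut (flip_split u' cy').
case: C => [[a f|b']|j' C D] in i red u cy sAB nA sA sA2 *.
- by rewrite Ab.
- by move: sA; rewrite Ab.
exfalso; apply: (@red_right A j' C D b Ab sA) => x.
have uj : uniq (j' :: [:: j; p; k] ++ labs A ++ labs C ++ labs D ++ labs B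
              ++ slabs (Cyc true s)).
  suff /perm_uniq <- : perm_eq
    (slabs (Cyc true ((p, Node j A (Node j' C D)) :: (k, B) :: s)))
    (j' :: [:: j; p; k] ++ labs A ++ labs C ++ labs D ++ labs B
              ++ slabs (Cyc true s)) by [].
  by rewrite /=; count_perm.
have : stC (Cyc true ((p, Node j A (Node j' C D)) :: (k, B) :: s)) j' x <= 0.
  by apply: red; rewrite /= !(inE, mem_cat) eqxx !orbT.
move: uj => /andP[+ _]; rewrite mem_cat negb_or => /andP[+].
rewrite !inE !mem_cat !negb_or => /and3P[jj jp jk] /and5P[jA jC jD jB js].
have jj' : j' \notin [:: j] by rewrite inE.
rewrite /stC caps2 big_cons -(nodeC_right x jj' jA jC jD).
have [_ _ ->] := caps_free jp jk jB js x.
have [||| _ _ ->] := @cap_free true j' (p, Node j A (Node j' C D), k) _ _ _ x => //.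
by rewrite addr0 add0r.
Qed.

Lemma all_split (T : Type) (a : pred T) s :
  (forall s1 x s2, s = s1 ++ x :: s2 -> a x) -> all a s.
Proof.
elim: s => // x s IHs h /=; rewrite (h [::] x s) //=.
by apply: IHs => s1 y s2 sE; apply: (h (x :: s1) y s2); rewrite sE.
Qed.

(** Beyond [final_flag], a bare [Lam] edge must be unflagged: a flagged edge follows a [Mu] edge,
    but the preceding sector ends in [Lam]. *)
Lemma red_notched s : inv (Cyc true s) -> all_red (Cyc true s) ->
  all (fun x => final x.2) s.
Proof.
move=> i red; apply: all_split => s1 [p t] s2 sE; rewrite {}sE in i red.
have {}i := inv_cat i; have {}red := red_rot red; rewrite cat_cons in i red.
case/lastP: (s2 ++ s1) (i) (red) => [[]//|s' [q C]].
rewrite -cats1 -!cat_cons => /inv_cat i1 /red_rot red1.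
have fC : final_flag C by apply: red_notched_head i1 red1.
have ft : final_flag t.
  move: (i) (red); case: (s2 ++ s1) => [[]//|[k B] s3].
  exact: red_notched_head.
case: i1 => _ /cycle_link_sorted; rewrite /= catA => /sorted_catW[+ _] _.
case: t ft {i red red1} => [[a [] _|b]|k l r ft] //= .
by case: C fC => [[a' f|b]|k [[a' f|b]|? ? ?] [[a'' f'|b']|? ? ?]] //= _;
  rewrite /link /= ?andbF.
Qed.

(** A final sector has exactly one [Lam] edge, and [phiT] of a final ear counts its [Mu] edge and
    the flag of its [Lam] edge. *)
Lemma phi_final s : all (fun x => final x.2) s ->
  (count isLam (sleaves (Cyc true s)))%:Z - 2
  + (count isMu (sleaves (Cyc true s)))%:Z
  + (count flag (sleaves (Cyc true s)))%:Z <= phi (Cyc true s).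
Proof.
move=> h; rewrite /phi /=.
suff : (count isLam (sleaves (Cyc true s)))%:Z
  + (count isMu (sleaves (Cyc true s)))%:Z
  + (count flag (sleaves (Cyc true s)))%:Z
  <= (size s)%:Z + \sum_(x <- s) (phiT x.2 + 0) by rewrite /=; lia.
elim: s h => [|[p t] s IHs] /=; first by rewrite big_nil.
move=> /andP[ht /IHs]; rewrite big_cons !count_cat /=.
move: (\sum_(x <- s) _) (count isLam _) (count isMu _) (count flag _) => x n1 n2 n3.
case: t ht => [[a []|b]|k [[a f|b]|? ? ?] [[a' f'|b']|? ? ?]] //= _; lia.
Qed.

(** * Comparison with mutations of the framed quiver *)

Definition sim S (R : quiver (V + V)%type) := forall i j,
  stB S i j = (arr R (inl i) (inl j))%:Z - (arr R (inl j) (inl i))%:Z /\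
  stC S i j = (arr R (inl i) (inr j))%:Z - (arr R (inr j) (inl i))%:Z.

Lemma mutate_ll (R : quiver (V + V)%type) k i j :
  let m := arr (mutate (frozen_vertices V) (inl k) R) in
  (m (inl i) (inl j))%:Z - (m (inl j) (inl i))%:Z =
  mutB (fun i j => (arr R (inl i) (inl j))%:Z - (arr R (inl j) (inl i))%:Z) k i j.
Proof.
have posE x y : pos ((arr R x y)%:Z - (arr R y x)%:Z) = (arr R x y)%:Z.
  by rewrite /pos; case: ifP; case: (arr_no2cycle R x y) => ->; lia.
have inlE (x y : V) : (inl V x == inl y :> V + V) = (x == y) by [].
have k0 := arr_noloop R (inl k).
rewrite /= /mut_arr /remove_frozen !inE /= /cancel_2cycles /reverse_at /add_paths.
rewrite /mutB !posE !inlE orbC.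
have [->|jk] := eqVneq j k; have [->|ik] := eqVneq i k; rewrite /= ?k0; lia.
Qed.

Lemma mutate_lr (R : quiver (V + V)%type) k i j : green R k ->
  let m := arr (mutate (frozen_vertices V) (inl k) R) in
  (m (inl i) (inr j))%:Z - (m (inr j) (inl i))%:Z =
  mutC (fun i j => (arr R (inl i) (inl j))%:Z - (arr R (inl j) (inl i))%:Z)
       (fun i j => (arr R (inl i) (inr j))%:Z - (arr R (inr j) (inl i))%:Z) k i j.
Proof.
move=> /(_ j) gk.
have posE x y : pos ((arr R x y)%:Z - (arr R y x)%:Z) = (arr R x y)%:Z.
  by rewrite /pos; case: ifP; case: (arr_no2cycle R x y) => ->; lia.
have inlE (x y : V) : (inl V x == inl y :> V + V) = (x == y) by [].
have k0 := arr_noloop R (inl k).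
rewrite /= /mut_arr /remove_frozen !inE /= /cancel_2cycles /reverse_at /add_paths.
rewrite /mutC !posE !inlE gk orbF.
have [->|ik] := eqVneq i k; rewrite /= ?k0; lia.
Qed.

Lemma sim_step S R k : sim S R -> green R k -> inv S -> (forall v, v \in slabs S) ->
  exists S', [/\ sim S' (mutate (frozen_vertices V) (inl k) R), inv S',
    forall v, v \in slabs S',
    forall a, count a (sleaves S') = count a (sleaves S) &
    phi S' <= phi S + 1].
Proof.
move=> sS gk iS lS.
have [S' [ck [fl pl [lv cy] b2 ph]]] := nextP iS (lS k).
have [ckE upd] := flip_mut fl.
have {}upd : forall i j, stB S' i j = mutB (stB S) k i j /\
                         stC S' i j = mutC (stB S) (stC S) k i j.
  apply: upd => j; rewrite -ckE; have [_ ->] := sS k j; rewrite gk; lia.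
exists S'; split=> //.
- move=> i j; rewrite mutate_ll mutate_lr //; have [-> ->] := upd i j.
  rewrite /mutB /mutC.
  have [-> _] := sS i j; have [_ ->] := sS i j.
  have [-> _] := sS i k; have [-> _] := sS k j.
  have [-> _] := sS j k; have [-> _] := sS k i; have [_ ->] := sS k j.
  by [].
- by split=> //; rewrite (perm_uniq pl); case: iS.
- by move=> v; rewrite (perm_mem pl).
Qed.

(** Each mutation raises [phi] by at most 1, and the last state is notched, so [phi_final] applies.
    More than two [Lam] edges are required to exclude [Dbl]. *)
Lemma sim_bound s S R : sim S R -> inv S -> (forall v, v \in slabs S) ->
  (2 < count isLam (sleaves S))%N ->
  (forall s1 i s2, s = s1 ++ i :: s2 ->
     green (mutations (frozen_vertices V) (map inl s1) R) i) ->
  (forall i, red (mutations (frozen_vertices V) (map inl s) R) i) ->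
  (count isLam (sleaves S))%:Z - 2 + (count isMu (sleaves S))%:Z
    + (count flag (sleaves S))%:Z <= phi S + (size s)%:Z.
Proof.
elim: s S R => [|k s IHs] S R sS iS lS cS gr re.
  have red : all_red S.
    by move=> k _ j; have [_ ->] := sS k j; rewrite (re k j); lia.
  case: S => [[] s|p q A B] in sS iS lS cS red *.
  - by have := phi_final (red_notched iS red); rewrite addr0.
  - by case: (not_red_plain iS red).
  - by case: (not_red_dbl iS cS red).
have [S' [sS' iS' lS' cE ph]] := sim_step sS (gr [::] k s erefl) iS lS.
have := IHs S' _ sS' iS' lS'; rewrite !cE => /(_ cS).
have gr' s1 i s2 : s = s1 ++ i :: s2 -> green (mutations (frozen_vertices V)
   (map inl s1) (mutate (frozen_vertices V) (inl k) R)) i.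
  by move=> sE; apply: (gr (k :: s1) i s2); rewrite sE.
move=> /(_ gr' re); rewrite /=; move: ph; clear.
move: (count isLam _) (count isMu _) (count flag _) (phi _) (phi _) => *; lia.
Qed.

End Triangulations.

(** * The initial triangulation of a Type IV quiver *)

Section Initial.
Local Open Scope ring_scope.
Variables (V : finType) (Q : quiver V) (k : nat) (a : 'I_k -> V) (b : 'I_k -> option V).
Variable C : 'I_k -> {set V}.
Hypothesis Q4 : typeIV Q a b C.
Hypothesis C1 : forall i, C i = set0 \/ exists x, C i = [set x].

Lemma b_set i x : b i = Some x -> C i = [set x].
Proof.
move=> bi; have := typeIV_spike_in Q4 bi.
by case: (C1 i) => [->|[y ->]]; rewrite inE // => /eqP->.
Qed.

Lemma b_notin i x : b i = Some x -> forall j, a j != x.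
Proof.
move=> /(typeIV_spike_notin Q4) + j; apply: contraNneq => <-.
exact: codom_f.
Qed.

Lemma b_inj i j x : b i = Some x -> b j = Some x -> i = j.
Proof.
move=> /b_set Ci /b_set Cj; apply/eqP; apply: contraT => /(typeIV_disjoint Q4).
by rewrite Ci Cj disjoints1 inE eqxx.
Qed.

Lemma b_notset0 i : (C i != set0) = (b i != None).
Proof.
apply/idP/idP => [/(typeIV_connecting Q4)[x ->]//|].
by case bi: (b i) => [x|//] _; rewrite (b_set bi); apply/set0Pn; exists x; rewrite inE.
Qed.

Lemma a_inj : injective a. Proof. by case: (typeIV_cycle Q4). Qed.

Variant vertex_spec x : Type :=
  | OnCycle i of x = a i
  | Spike i of b i = Some x.

Lemma vertexP x : vertex_spec x.
Proof.
have [/codomP/sig_eqW[i ->]|xa] := boolP (x \in codom a); first exact: (@OnCycle _ i).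
have /sigW[i xi] : exists i, x \in C i by apply/(typeIV_cover Q4).
apply: (@Spike _ i).
have Ci : C i != set0 by apply/set0Pn; exists x.
have [y by_ _] := typeIV_connecting Q4 Ci.
have := b_set by_ => CE; have : x \in [set val y] by rewrite -CE.
by rewrite inE by_ => /eqP->.
Qed.

Lemma arr_aa i j : arr Q (a i) (a j) = (j == ordS i).
Proof. by case: (typeIV_cycle Q4). Qed.

Lemma arr_ba i x j : b i = Some x -> arr Q x (a j) = (i == j).
Proof.
move=> bi; have xa := typeIV_spike_notin Q4 bi.
have [<-|ij] := eqVneq i j.
  have [_ /(_ 0 1)] := typeIV_spike Q4 bi.
  by rewrite !(tnth_nth x).
apply/eqP; rewrite -leqn0 leqNgt; apply: contra_neqN ij => /(typeIV_into_R Q4 xa).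
exact: b_inj.
Qed.

Lemma arr_ab i x j : b i = Some x -> arr Q (a j) x = (j == ordS i).
Proof.
move=> bi; have xa := typeIV_spike_notin Q4 bi.
have [->|ij] := eqVneq j (ordS i).
  have [_ /(_ (Ordinal (isT : (2 < 3)%N)) 0)] := typeIV_spike Q4 bi.
  by rewrite !(tnth_nth x).
apply/eqP; rewrite -leqn0 leqNgt; apply: contra_neqN ij.
rewrite -(ord_predK j) => /(typeIV_from_R Q4 xa) bj.
by rewrite (b_inj bi bj).
Qed.

Lemma arr_bb i x j y : b i = Some x -> b j = Some y -> arr Q x y = 0%N.
Proof.
move=> bi bj; have [ij|ij] := eqVneq i j.
  by move: bj; rewrite -ij bi => -[<-]; exact: arr_noloop.
exact: (typeIV_separated Q4 ij (typeIV_spike_in Q4 bi) (typeIV_spike_in Q4 bj)).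
Qed.

Definition deg4 i := (b i != None) && (b (ord_pred i) != None).

Definition sector i : tree V :=
  if b i is Some x then Node x (Leaf (Lam (a i) (deg4 i))) (Leaf (Mu x))
  else Leaf (Lam (a i) (deg4 i)).

Definition init := Cyc false [seq (a i, sector i) | i <- enum 'I_k].

Lemma rot_enum : rot 1 (enum 'I_k) = [seq ordS i | i <- enum 'I_k].
Proof.
apply: (inj_map val_inj); rewrite map_rot val_enum_ord -map_comp.
have -> : [seq (val \o (@ordS k)) i | i <- enum 'I_k] =
    [seq (i.+1 %% k)%N | i <- iota 0 k] by rewrite -val_enum_ord -map_comp.
case: (k) => // n; have -> : rot 1 (iota 0 n.+1) = rcons (iota 1 n) 0%N.
  by rewrite -rot1_cons.
apply: (@eq_from_nth _ 0%N); rewrite ?size_rcons ?size_map ?size_iota // => i.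
rewrite ltnS leq_eqVlt => /orP[/eqP->|li].
  rewrite nth_rcons size_iota ltnn eqxx (nth_map 0%N) ?size_iota //.
  by rewrite (nth_iota 0 0) // add0n modnn.
rewrite nth_rcons size_iota li (nth_map 0%N) ?size_iota ?nth_iota //.
  by rewrite add1n add0n modn_small.
all: by rewrite ltnS ltnW.
Qed.

Lemma caps_init : caps [seq (a i, sector i) | i <- enum 'I_k] =
  [seq ((a i, sector i), a (ordS i)) | i <- enum 'I_k].
Proof.
by rewrite /caps /unzip1 -map_comp -map_rot rot_enum -!map_comp zip_map.
Qed.
Lemma lab_sector i : lab (sector i) = if b i is Some x then [:: x] else [::].
Proof. by rewrite /sector; case: (b i). Qed.

Lemma ind_sector i x : ind (lab (sector i)) x = (b i == Some x)%:Z.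
Proof.
rewrite lab_sector /ind; case: (b i) => [y|//]; rewrite inE eq_sym.
by rewrite -(inj_eq Some_inj).
Qed.

Lemma sum1 (F : 'I_k -> int) i0 : (forall i, i != i0 -> F i = 0) ->
  \sum_i F i = F i0.
Proof. by move=> F0; rewrite (bigD1 i0) //= big1 ?addr0. Qed.

(** Each vertex is exactly one [a i] or one spike; this turns statements about vertices into sums
    over sectors. *)
Lemma vertex_sum x : \sum_i ((a i == x)%:Z + (b i == Some x)%:Z) = 1 :> int.
Proof.
case: (vertexP x) => i0 xE.
  rewrite (sum1 (i0 := i0)) => [|i ii0].
    by rewrite xE eqxx; case: eqP => // /b_notin/(_ i0); rewrite eqxx.
  rewrite xE (inj_eq a_inj) (negbTE ii0).
  by case: eqP => // /b_notin/(_ i0); rewrite eqxx.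
rewrite (sum1 (i0 := i0)) => [|i ii0].
  by rewrite xE eqxx (negbTE (b_notin xE i0)).
rewrite (negbTE (b_notin xE i)); case: eqP => // /b_inj/(_ xE) ii.
by rewrite ii eqxx in ii0.
Qed.

Lemma init_sum (T : Type) (F : V * tree V -> seq T) :
  flatten [seq F x | x <- [seq (a i, sector i) | i <- enum 'I_k]] =
  flatten [seq F (a i, sector i) | i <- enum 'I_k].
Proof. by rewrite -map_comp. Qed.

Lemma count_flatten_enum (T : Type) (p : pred T) (F : 'I_k -> seq T) :
  count p (flatten [seq F i | i <- enum 'I_k]) = (\sum_i count p (F i))%N.
Proof.
by rewrite count_flatten -map_comp sumnE big_map big_enum.
Qed.

Lemma sumZ (F : 'I_k -> nat) : (\sum_i F i)%N%:Z = \sum_i (F i)%:Z :> int.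
Proof. exact: (big_morph Posz PoszD (erefl _)). Qed.

Lemma count_slabs x : count_mem x (slabs init) = 1%N.
Proof.
apply/eqP; rewrite -eqz_nat -(vertex_sum x) /= init_sum count_flatten_enum sumZ.
apply/eqP/eq_bigr => i _ /=; rewrite PoszD; congr (_ + _).
by rewrite /sector; case: (b i) => [y|//] /=; rewrite addn0.
Qed.

Lemma init_stC x y : stC init x y = (x == y)%:Z.
Proof.
rewrite /= caps_init big_map big_enum /=.
transitivity (\sum_i ((a i == x)%:Z * (a i == y)%:Z
                     + (b i == Some x)%:Z * (b i == Some y)%:Z) : int).
  apply: eq_bigr => i _; rewrite /capC !mul0r addr0 /= /sector /ind !inE.
  case: (b i) => [z|] /=; last by rewrite -!(eq_sym (a i)); ring.
  rewrite /nodeC /chi /ind !inE /= !(inj_eq Some_inj) -!(eq_sym (a i)) -!(eq_sym z).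
  by ring.
have [->|xy] := eqVneq x y.
  rewrite -[RHS](vertex_sum y); apply: eq_bigr => i _.
  by case: (a i == y); case: (b i == _).
rewrite big1 // => i _.
have [ax|_] := eqVneq (a i) x.
  rewrite ax (negbTE xy) mulr0 add0r; case: eqP => [bx|_]; last by rewrite mul0r.
  by have := b_notin bx i; rewrite ax eqxx.
rewrite mul0r add0r; case: eqP => [->|_]; last by rewrite mul0r.
by rewrite (inj_eq Some_inj) (negbTE xy) mulr0.
Qed.

(** The share of sector [i]: the triangle on the spike, or only the cycle arrow if there is no
    spike. *)
Definition arrows x y i : int :=
  (b i == Some x)%:Z * (a i == y)%:Z + (a i == x)%:Z * (a (ordS i) == y)%:Z
  + (a (ordS i) == x)%:Z * (b i == Some y)%:Z.

Lemma arr_sum x y : (arr Q x y)%:Z = \sum_i arrows x y i.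
Proof.
have ab0 i0 i (bi : b i = Some (a i0)) : false.
  by have := b_notin bi i0; rewrite eqxx.
have bF i0 i : (b i == Some (a i0)) = false by apply/eqP => /ab0.
have aE i j : (a i == a j) = (i == j) by exact: (inj_eq a_inj).
case: (vertexP x) => i0 xE; case: (vertexP y) => j0 yE.
- rewrite xE yE arr_aa (sum1 (i0 := i0)) => [|i ii0].
    by rewrite /arrows !bF !aE eqxx mul0r mulr0 add0r addr0 mul1r eq_sym.
  by rewrite /arrows !bF !aE (negbTE ii0) !mul0r mulr0 !addr0.
- rewrite xE (arr_ab _ yE) (sum1 (i0 := j0)) => [|i ii0].
    rewrite /arrows bF yE eqxx aE mulr1 mul0r add0r (negbTE (b_notin yE _)) mulr0 add0r.
    by rewrite aE eq_sym.
  rewrite /arrows bF !mul0r add0r (negbTE (b_notin yE _)) mulr0 add0r.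
  by case: (b i =P _) => [/b_inj/(_ yE) ij|_]; [rewrite ij eqxx in ii0 | rewrite mulr0].
- rewrite yE (arr_ba _ xE) (sum1 (i0 := i0)) => [|i ii0].
    by rewrite /arrows !bF xE eqxx mul1r aE !(negbTE (b_notin xE _)) !mul0r !addr0.
  rewrite /arrows !(negbTE (b_notin xE _)) !mul0r !addr0.
  by case: (b i =P _) => [/b_inj/(_ xE) ij|_]; [rewrite ij eqxx in ii0 | rewrite mul0r].
rewrite (arr_bb xE yE) big1 // => i _.
by rewrite /arrows !(negbTE (b_notin xE _)) !(negbTE (b_notin yE _)) mulr0 !mul0r.
Qed.

Lemma init_stB x y : stB init x y = (arr Q x y)%:Z - (arr Q y x)%:Z.
Proof.
rewrite /= caps_init big_map big_enum /= !arr_sum -sumrB.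
apply: eq_bigr => i _; rewrite /capB /tri /= !ind_sector /arrows.
have -> : treeB (sector i) x y = 0.
  by rewrite /sector; case: (b i) => [z|] //=; rewrite /nodeB /tri /ind !in_nil /=; ring.
rewrite /ind !inE -!(eq_sym (a _)); ring.
Qed.

Lemma init_sim : sim init (framed Q).
Proof.
move=> x y; split; first exact: init_stB.
by rewrite init_stC /= subr0.
Qed.

(** * Degrees, initial counts and the final inequality *)

Definition nspike i : int := (b i != None)%:Z.

Lemma sum_eq (x : V) : \sum_w (x == w)%:Z = 1 :> int.
Proof. by rewrite (bigD1 x) //= eqxx big1 ?addr0 // => w; rewrite eq_sym => /negbTE->. Qed.

Lemma sum_spike i : \sum_w (b i == Some w)%:Z = nspike i.
Proof.
rewrite /nspike; case: (b i) => [x|]; last by rewrite big1.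
by rewrite -[RHS](sum_eq x); apply: eq_bigr => w _; rewrite (inj_eq Some_inj).
Qed.

Lemma deg_init i : (degree Q (a i))%:Z = 2 + nspike i + nspike (ord_pred i).
Proof.
have bF j : (b j == Some (a i)) = false.
  by apply/eqP => bj; have := b_notin bj i; rewrite eqxx.
have aE j l : (a j == a l) = (j == l) by exact: (inj_eq a_inj).
have SE j : (ordS j == i) = (j == ord_pred i) by rewrite -[RHS](can_eq (@ordSK k)) ord_predK.
rewrite /degree (big_morph Posz PoszD (erefl _)).
transitivity (\sum_j ((j == i)%:Z * (1 + nspike j)
                     + (j == ord_pred i)%:Z * (1 + nspike j))); last first.
  rewrite big_split /= (sum1 (i0 := i)) => [|j ji]; last by rewrite (negbTE ji) mul0r.
  rewrite (sum1 (i0 := ord_pred i)) => [|j ji]; last by rewrite (negbTE ji) mul0r.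
  by rewrite !eqxx !mul1r; ring.
under eq_bigr => w _ do rewrite PoszD !arr_sum -big_split /=.
rewrite exchange_big; apply: eq_bigr => j _ /=; rewrite big_split /=.
have -> : \sum_w arrows (a i) w j = (j == i)%:Z * \sum_w (a (ordS j) == w)%:Z
                          + (j == ord_pred i)%:Z * \sum_w (b j == Some w)%:Z.
  rewrite !mulr_sumr -big_split; apply: eq_bigr => w _.
  by rewrite /arrows bF !aE SE /=; ring.
have -> : \sum_w arrows w (a i) j = (j == i)%:Z * \sum_w (b j == Some w)%:Z
                          + (j == ord_pred i)%:Z * \sum_w (a j == w)%:Z.
  rewrite !mulr_sumr -big_split; apply: eq_bigr => w _.
  by rewrite /arrows bF !aE SE /=; ring.
by rewrite !sum_eq sum_spike; ring.
Qed.

Lemma deg4E i : deg4 i = (degree Q (a i) == 4).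
Proof.
rewrite -eqz_nat deg_init /nspike /deg4.
by case: (b i); case: (b (ord_pred i)).
Qed.

Lemma init_counts :
  [/\ count (@isLam V) (sleaves init) = k,
      count (@isMu V) (sleaves init) = #|[set i | C i != set0]| &
      count (@flag V) (sleaves init) = #|[set i | degree Q (a i) == 4]|].
Proof.
rewrite /= init_sum !count_flatten_enum; split.
- rewrite (eq_bigr (fun=> 1%N)) ?sum1_card ?card_ord // => i _.
  by rewrite /sector; case: (b i).
- rewrite -sum1_card [RHS]big_mkcond; apply: eq_bigr => i _.
  by rewrite inE b_notset0 /sector; case: (b i).
rewrite -sum1_card [RHS]big_mkcond; apply: eq_bigr => i _.
rewrite inE -deg4E /sector; case bi: (b i) => [x|] /=; rewrite !addn0 //.
all: by case: (deg4 i).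
Qed.

(** In an initial ear the left leg is [Lam] and the right leg [Mu], both of weight 0, and a sector
    without spike is unflagged. *)
Lemma init_phi : phi init = - k%:Z.
Proof.
rewrite /= size_map size_enum_ord big_map big1 ?addr0 // => i _.
by rewrite /sector /deg4; case: (b i).
Qed.

Definition first_leaf i : leaf V := Lam (a i) (deg4 i).
Definition last_leaf i : leaf V := if b i is Some x then Mu x else first_leaf i.

Lemma path_sectors l i j : path (frel (@ordS k)) i (rcons l j) ->
  path (@link V) (last_leaf i)
    (rcons (flatten [seq leaves (sector m) | m <- l]) (first_leaf j)).
Proof.
(* A flagged first edge means that the preceding sector has a spike, hence ends in [Mu]. *)
have lS m : link (last_leaf m) (first_leaf (ordS m)).
  rewrite /link /last_leaf /first_leaf /= /deg4 ordSK.
  by case: (b m) => [x|] /=; rewrite ?implybT ?andbF.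
elim: l i => [|m l IHl] i /=; first by rewrite andbT => /eqP<-; rewrite lS.
move=> /andP[/eqP<- /IHl]; have := lS i.
by rewrite rcons_cat /sector /last_leaf; case: (b (ordS i)) => [x|] /= -> .
Qed.

Lemma cycle_enum : fcycle (@ordS k) (enum 'I_k).
Proof.
case eE: (enum 'I_k) => [//|i0 l]; have := rot_enum; rewrite eE rot1_cons /= => lE.
rewrite lE; apply/(pathP i0) => -[|n] /=; rewrite ?eqxx // size_map ltnS => nl.
by rewrite -lE nth_rcons nl (nth_map i0).
Qed.

Lemma init_inv : inv init /\ forall v, v \in slabs init.
Proof.
have vin v : v \in slabs init by rewrite -has_pred1 has_count count_slabs.
split=> //; split.
- by apply: count_mem_uniq => v; rewrite count_slabs vin.
- rewrite /= init_sum; case: (enum 'I_k) cycle_enum => [//|i0 l] /path_sectors /=.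
  by rewrite /last_leaf /sector; case: (b i0) => [x|].
- by rewrite /= size_map size_enum_ord; have := typeIV_ge3 Q4; lia.
Qed.

Lemma mgs_length s : maximal_green_sequence Q s ->
  (2 * k - 2 + #|[set i | C i != set0]| + #|[set i | degree Q (a i) == 4]|
     <= size s)%N.
Proof.
move=> [gr re]; have [iS lS] := init_inv; have [cL cM cF] := init_counts.
have k3 := typeIV_ge3 Q4.
(* With t and m the two cardinals, this reads [k - 2 + t + m <= - k + size s]. *)
have := sim_bound init_sim iS lS _ gr re.
rewrite cL cM cF init_phi => /(_ k3); move: k3; clear.
move: #|_| #|_| => t m; lia.
Qed.

End Initial.

Theorem theorem8p12 (V : finType) (Q : quiver V) (k : nat)
  (a : 'I_k -> V) (b : 'I_k -> option V) (C : 'I_k -> {set V})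
  (Q_typeIV : typeIV Q a b C)
  (C_small : forall i : 'I_k, C i = set0 \/ exists x : V, C i = [set x])
  (s : seq V) (s_mgs : maximal_green_sequence Q s) :
  2 * k - 2 + #|[set i : 'I_k | C i != set0]|
    + #|[set i : 'I_k | degree Q (a i) == 4]| <= size s.
Proof. exact: mgs_length Q_typeIV C_small _ s_mgs. Qed.
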